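(* Let $N=\{1,\dots,n\}$ be a finite set of agents with common signal space $S=[\underline{s},\overline{s}]\subset\mathbb{R}$ and signals drawn independently and identically from a distribution $F$ with density $f>0$ on $S$. For each $i\in N$ let $v_i:S^n\to\mathbb{R}$ be such that, for every $s_{-i}$, the map $s_i\mapsto v_i(s_i,s_{-i})$ is convex, continuous and non-decreasing on $S$. If $(q,p)$ is an optimal mechanism, then $q$ is eventually monotone and $q$ maximizes $$\int_{s \in S^n} \Bigl[ \sum_{i \in N} J_i (s)\, q_i(s) \Bigr] f(s)\, ds$$ within the class of eventually monotone allocation rules.
   Context: For a signal profile $s\in S^n$, $s_{-i}$ denotes the signals of the agents other than $i$, $(s_i,s_{-i})=s$, and $f(s)=\prod_{j\in N}f(s_j)$. There is a single object. An allocation rule is a tuple $q=(q_i)_{i\in N}$ of measurable functions $q_i:S^n\to[0,1]$ with $\sum_{i\in N}q_i(s)\le 1$ for all $s$. A mechanism is a pair $(q,p)$ of an allocation rule and a payment rule $p=(p_i)_{i\in N}$, with $p_i:S^n\to\mathbb{R}$ measurable. The net payoff of agent $i$ is $u_i(s_i,s_{-i})=q_i(s_i,s_{-i})v_i(s_i,s_{-i})-p_i(s_i,s_{-i})$. EPIC (ex-post incentive compatible): for all $i$, $s_{-i}$ and $s_i,s_i'\in S$, $u_i(s_i,s_{-i})\ge u_i(s_i',s_{-i})+[v_i(s_i,s_{-i})-v_i(s_i',s_{-i})]q_i(s_i',s_{-i})$. EPIR (ex-post individually rational): $u_i(s_i,s_{-i})\ge 0$ for all $i$, $s_i$, $s_{-i}$.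 The expected revenue of $(q,p)$ is $\sum_{i\in N}\int_{S^n}p_i(s)f(s)\,ds$. A mechanism is optimal if it is EPIC and EPIR and its expected revenue is at least that of any other EPIC and EPIR mechanism. Eventually monotone: with $\ell_{v_i}(s_{-i}):=\sup\{s_i\in S: v_i(s_i,s_{-i})=v_i(\underline{s},s_{-i})\}$, $q$ is eventually monotone if for all $i$, $s_{-i}$, and all $s_i,s_i'\in S$ with $s_i>s_i'$ and $s_i>\ell_{v_i}(s_{-i})$, we have $q_i(s_i,s_{-i})\ge q_i(s_i',s_{-i})$. Virtual value: $J_i(s_i,s_{-i})=v_i(s_i,s_{-i})-\frac{1-F(s_i)}{f(s_i)}\frac{\partial v_i(s_i,s_{-i})}{\partial s_i}$, where the partial derivative is the derivative of the convex function $v_i(\cdot,s_{-i})$ where it exists (almost everywhere) and otherwise some selection from its subgradient. Regularity so that expectations are well defined: each $v_i$ is jointly measurable, and $s_{-i}\mapsto v_i(\underline{s},s_{-i})$ and $s_{-i}\mapsto v_i(\overline{s},s_{-i})$ are integrable with respect to $\prod_{j\neq i}f(s_j)ds_j$. (Under EPIR, $p_i\le q_iv_i$, so expected revenue is then well defined in $[-\infty,\infty)$.) *)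

(* Defs.v *)
From HB Require Import structures.
From mathcomp Require Export all_boot all_order all_algebra.
From mathcomp Require Export all_classical all_reals all_analysis.
From mathcomp Require Export measurable_realfun.

Set Implicit Arguments.
Unset Strict Implicit.
Unset Printing Implicit Defensive.

Import Order.TTheory GRing.Theory Num.Theory.
Import numFieldNormedType.Exports.

Local Open Scope classical_set_scope.
Local Open Scope ring_scope.

(* The library has binary but no n-ary product measures. Lebesgue measure on
   R^m (with the product sigma-algebra of m.-tuple R) is defined recursively:
   the unit point mass for m = 0; for m.+1, the image of the binary product
   of the measures on R and R^m under (x, t) |-> x :: t. *)
Section lebesgue_cons.
Local Open Scope ereal_scope.
Context (R : realType) (m : nat).
Variable mu : {sigma_finite_measure set (m.-tuple R) -> \bar R}.

Definition tuple_cons (xt : measurableTypeR R * m.-tuple R) : m.+1.-tuple R :=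
  [the m.+1.-tuple R of xt.1 :: xt.2].

Lemma measurable_tuple_cons : measurable_fun [set: measurableTypeR R * m.-tuple R] tuple_cons.
Proof. exact: measurable_cons. Qed.

Definition lebesgue_cons : set (m.+1.-tuple R) -> \bar R :=
  pushforward (@lebesgue_measure R \x mu) tuple_cons.

Let measurable_preimage (A : set (m.+1.-tuple R)) :
  measurable A -> measurable (tuple_cons @^-1` A).
Proof. by move=> mA; rewrite -[X in measurable X]setTI; exact: measurable_tuple_cons. Qed.

Let lebesgue_cons0 : lebesgue_cons set0 = 0.
Proof. by rewrite /lebesgue_cons /pushforward preimage_set0 measure0. Qed.

Let lebesgue_cons_ge0 A : 0 <= lebesgue_cons A.
Proof. exact: (@measure_ge0 _ _ _ (@lebesgue_measure R \x mu)). Qed.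

Let lebesgue_cons_sigma_additive : semi_sigma_additive lebesgue_cons.
Proof.
move=> F mF tF mUF; rewrite /lebesgue_cons /pushforward preimage_bigcup.
apply: measure_semi_sigma_additive.
- by move=> k; exact: measurable_preimage.
- apply/trivIsetP => /= i j _ _ ij; rewrite -preimage_setI.
  by move/trivIsetP : tF => /(_ _ _ _ _ ij) ->//; rewrite preimage_set0.
- by rewrite -preimage_bigcup; exact: measurable_preimage.
Qed.

HB.instance Definition _ := isMeasure.Build _ _ _ lebesgue_cons
  lebesgue_cons0 lebesgue_cons_ge0 lebesgue_cons_sigma_additive.

Let lebesgue_cons_sigma_finite : sigma_finite setT lebesgue_cons.
Proof.
have /sigma_finiteP[F [FT ndF Foo]] := sigma_finiteT (@lebesgue_measure R).
have /sigma_finiteP[G [GT ndG Goo]] := sigma_finiteT mu.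
pose H k := [set s : m.+1.-tuple R | F k (thead s) /\ G k [tuple of behead s]].
have mH k : measurable (H k).
  have [mF _] := Foo k; have [mG _] := Goo k.
  apply: measurableI; rewrite -[X in measurable X]setTI.
    exact: (measurable_tnth ord0).
  exact: measurable_behead.
exists H.
  apply/esym; rewrite -subTset => s _.
  have [i _ Fi] : (\bigcup_k F k) (thead s) by rewrite -FT.
  have [j _ Gj] : (\bigcup_k G k) [tuple of behead s] by rewrite -GT.
  exists (maxn i j) => //; split.
    by move: (thead s) Fi; exact/subsetPset/ndF/leq_maxl.
  by move: [tuple of behead s] Gj; exact/subsetPset/ndG/leq_maxr.
move=> k; split; first exact: mH.
have [mF Fk] := Foo k; have [mG Gk] := Goo k.
rewrite /lebesgue_cons /pushforward (_ : _ @^-1` _ = F k `*` G k).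
  by rewrite product_measure1E// lte_mul_pinfty// ge0_fin_numE.
have bK (x : R) (t : m.-tuple R) : [tuple of behead (tuple_cons (x, t))] = t.
  exact: val_inj.
by apply/seteqP; split=> -[x t]; rewrite /H /= bK theadE.
Qed.

HB.instance Definition _ := Measure_isSigmaFinite.Build _ _ _ lebesgue_cons
  lebesgue_cons_sigma_finite.

End lebesgue_cons.

Fixpoint lebesgue_tuple (R : realType) (m : nat) :
    {sigma_finite_measure set (m.-tuple R) -> \bar R} :=
  match m with
  | 0 => \d_ [tuple]
  | m'.+1 => lebesgue_cons (lebesgue_tuple R m')
  end.

Lemma lebesgue_tuple_box (R : realType) (m : nat) (A : 'I_m -> set R) :
  (forall i, measurable (A i)) ->
  (lebesgue_tuple R m [set s | forall i, A i (tnth s i)] =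
   \prod_(i < m) lebesgue_measure (A i))%E.
Proof.
elim: m A => [|m IH] A mA /=.
  by rewrite big_ord0 diracE mem_set//=; case.
rewrite /lebesgue_cons/pushforward big_ord_recl -IH// -product_measure1E//.
- congr product_measure1; apply/seteqP; split => -[x t] /= H.
    split; first exact: (H ord0).
    by move=> i; have := H (lift ord0 i); rewrite /tuple_cons tnthS.
  case: H => Hx Ht i; case: (unliftP ord0 i) => [j ->|->]//.
  by rewrite /tuple_cons tnthS.
- exact: mA.
- rewrite [X in measurable X](_ : _ = \bigcap_(i in [set: 'I_m])
    [set s : m.-tuple R | A (lift ord0 i) (tnth s i)]).
    apply: fin_bigcap_measurable => // i _.
    rewrite -[X in measurable X]setTI; exact: (measurable_tnth i).
  by apply/seteqP; split => s /= H i; [move=> _; exact: H|exact: H].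
Qed.

Section auction.
Context (R : realType).
(* The signal space is S = [a, b]. *)
Variables (a b : R).

Definition cube (m : nat) : set (m.-tuple R) :=
  [set s | forall j, tnth s j \in `[a, b]].

Definition is_density (f : R -> R) :=
  [/\ measurable_fun `[a, b] f,
      forall x, x \in `[a, b] -> 0 < f x
    & (\int[lebesgue_measure]_(x in `[a, b]) (f x)%:E = 1)%E].

Definition cdf_of (f : R -> R) (x : R) : R :=
  \int[lebesgue_measure]_(y in `[a, x]) f y.

Definition joint (m : nat) (f : R -> R) (s : m.-tuple R) : R :=
  \prod_(j < m) f (tnth s j).

(* The profile (s_i, s_{-i}) for s_i = x and s_{-i} = t. *)
Definition profile (n : nat) (i : 'I_n) (x : R) (t : n.-1.-tuple R) :
    n.-tuple R :=
  [tuple if unlift i j is Some k then tnth t k else x | j < n].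

Definition is_subgradient (h : R -> R) (x g : R) :=
  forall y, y \in `[a, b] -> h x + g * (y - x) <= h y.

(* dh is the derivative of the convex function h on [a, b] where it exists,
   and otherwise a selection from the subgradient. At an end point of [a, b]
   h is only one-sidedly constrained, so the second clause applies there; the
   subgradient at b may be empty, and then dh b is unconstrained. *)
Definition is_derivative_selection (h dh : R -> R) :=
  forall x, x \in `[a, b] ->
    (a < x < b /\ derivable h x 1 -> dh x = derive1 h x) /\
    (~ (a < x < b /\ derivable h x 1) ->
       (exists g, is_subgradient h x g) -> is_subgradient h x (dh x)).

Section mechanisms.
Context (n : nat).
Implicit Types (v q p dv : 'I_n -> n.-tuple R -> R) (f : R -> R).

Definition valuation v :=
  forall i (t : n.-1.-tuple R), cube t ->
    let h x := v i (profile i x t) in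
    [/\ convex_function (E := R^o) `[a, b] h,
        {within `[a, b], continuous h}
      & {in `[a, b] &, {homo h : x y / x <= y}}].

Definition regular f v :=
  forall i, [/\ measurable_fun (@cube n) (v i),
    (lebesgue_tuple R n.-1).-integrable (@cube n.-1)
      (fun t => (v i (profile i a t) * joint f t)%:E)
  & (lebesgue_tuple R n.-1).-integrable (@cube n.-1)
      (fun t => (v i (profile i b t) * joint f t)%:E)].

Definition allocation_rule q :=
  [/\ forall i, measurable_fun (@cube n) (q i),
      forall i s, cube s -> 0 <= q i s <= 1
    & forall s, cube s -> \sum_(i < n) q i s <= 1].

Definition payment_rule p := forall i, measurable_fun (@cube n) (p i).

Definition net_payoff v q p (i : 'I_n) (s : n.-tuple R) : R :=
  q i s * v i s - p i s.

Definition EPIC v q p :=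
  forall i (t : n.-1.-tuple R), cube t ->
  forall x x', x \in `[a, b] -> x' \in `[a, b] ->
    net_payoff v q p i (profile i x' t)
      + (v i (profile i x t) - v i (profile i x' t)) * q i (profile i x' t)
    <= net_payoff v q p i (profile i x t).

Definition EPIR v q p := forall i s, cube s -> 0 <= net_payoff v q p i s.

(* Under EPIR every summand is in [-oo, +oo[, so the sum is unambiguous. *)
Definition revenue f p : \bar R :=
  (\sum_(i < n) \int[lebesgue_tuple R n]_(s in @cube n)
     (p i s * joint f s)%:E)%E.

Definition feasible v q p :=
  [/\ allocation_rule q, payment_rule p, EPIC v q p & EPIR v q p].

Definition optimal f v q p :=
  feasible v q p /\
  forall q' p', feasible v q' p' -> (revenue f p' <= revenue f p)%E.

Definition ell v (i : 'I_n) (t : n.-1.-tuple R) : R :=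
  sup [set x | x \in `[a, b] /\ v i (profile i x t) = v i (profile i a t)].

Definition eventually_monotone v q :=
  forall i (t : n.-1.-tuple R), cube t ->
  forall x x', x \in `[a, b] -> x' \in `[a, b] -> x' < x -> ell v i t < x ->
    q i (profile i x' t) <= q i (profile i x t).

(* dv i s plays the role of the partial derivative of v i in the signal of i. *)
Definition is_partial_derivative v dv :=
  forall i (t : n.-1.-tuple R), cube t ->
    is_derivative_selection (fun x => v i (profile i x t))
                            (fun x => dv i (profile i x t)).

Definition virtual_value f v dv (i : 'I_n) (s : n.-tuple R) : R :=
  v i s - (1 - cdf_of f (tnth s i)) / f (tnth s i) * dv i s.

Definition virtual_surplus f v dv q : \bar R :=
  (\int[lebesgue_tuple R n]_(s in @cube n)
     ((\sum_(i < n) virtual_value f v dv i s * q i s) * joint f s)%:E)%E.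

End mechanisms.
End auction.

(* Main.v *)
(* With s_{-i} fixed, write h = v_i(., s_{-i}), a convex function, and u for the
   payoff of agent i. The EPIC inequalities squeeze the increments of u, and if
   q is eventually monotone also those of the rent x |-> int_a^x q h', between
   q(x)(h(y) - h(x)) and q(y)(h(y) - h(x)), so u dominates the rent. Hence the
   payments p_i of a feasible mechanism are at most q_i v_i - rent_i, while for
   every eventually monotone q these are the payments of a feasible mechanism.
   By Tonelli the revenue of q_i v_i - rent_i is the virtual surplus of q.

   The selection dv need not be jointly measurable, and
   differentiability of h almost everywhere is not needed: dv is squeezed
   between the supremum L of the left and the infimum U of the right difference
   quotients, which are measurable subgradients of h; only the monotonicity of
   the integral is used for dv:
     surplus_dv(q') <= surplus_L(q') = revenue(p') <= revenue(p)
                    <= surplus_U(q) <= surplus_dv(q). *)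
Require Import Defs.
From mathcomp Require Import ring lra.
Set Implicit Arguments.
Unset Strict Implicit.
Unset Printing Implicit Defensive.
Import Order.TTheory GRing.Theory Num.Theory.
Import numFieldNormedType.Exports.
Local Open Scope classical_set_scope.
Local Open Scope ring_scope.

(** * Subgradients of a convex function *)

Section convex_on_interval.
Context (R : realType) (a b : R) (h : R -> R).
Hypothesis hc : convex_function (E := R^o) `[a, b] h.

Lemma convex_function_ineq t x y : 0 <= t -> t <= 1 ->
  x \in `[a, b] -> y \in `[a, b] ->
  h (t * x + (1 - t) * y) <= t * h x + (1 - t) * h y.
Proof.
move=> t0 t1 xab yab.
by apply: (hc (Itv01 t0 t1)); rewrite inE.
Qed.

(** The three-chord inequality, cross-multiplied so that no division remains. The weight [t] is the
    one for which [y = t * x + (1 - t) * z]. *)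
Lemma convex_function_slopes x y z : a <= x -> x < y -> y < z -> z <= b ->
  (h y - h x) * (z - y) <= (h z - h y) * (y - x).
Proof.
move=> ax xy yz zb.
have zx : 0 < z - x by lra.
pose t := (z - y) / (z - x).
have t0 : 0 <= t by apply: divr_ge0; lra.
have t1 : t <= 1 by rewrite ler_pdivrMr// mul1r; lra.
have tz : t * (z - x) = z - y by rewrite /t divfK// gt_eqF.
have := convex_function_ineq (x := x) (y := z) t0 t1.
rewrite !in_itv/= => /(_ ltac:(lra) ltac:(lra)).
have -> : t * x + (1 - t) * z = y by nra.
move: tz; move: (h x) (h y) (h z) => hx hy hz tz H; nra.
Qed.

(** Difference quotients are sampled only at the points dividing the way from [x] to the end point
    [c] by [n.+1]. They stay in [a, b], and there are countably many, so that their supremum or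
    infimum depends measurably on parameters. [c = a] gives left quotients, [c = b] right ones. *)
Definition slope (c : R) (n : nat) (x : R) : R :=
  (h (x + (c - x) / n.+1%:R) - h x) / ((c - x) / n.+1%:R).

Definition left_slope (x : R) : R := sup (range (slope a ^~ x)).
Definition right_slope (x : R) : R := inf (range (slope b ^~ x)).

Let interior_point (x c : R) (n : nat) : c != x ->
  exists e, [/\ 0 < e, e <= 1 & (c - x) / n.+1%:R = e * (c - x)].
Proof.
move=> cx; exists (n.+1%:R^-1); split; [by rewrite invr_gt0| |exact: mulrC].
by rewrite invf_le1// ler1n.
Qed.

Let small_fraction (d e : R) : 0 < d -> 0 < e -> exists n : nat, d / n.+1%:R <= e.
Proof.
move=> d0 e0; have [n dn] : exists n : nat, d / e < n%:R.
  by exists (Num.bound (d / e)); rewrite archi_boundP// divr_ge0// ltW.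
exists n; rewrite ler_pdivrMr// mulrC -ler_pdivrMr// (le_trans (ltW dn))//.
by rewrite ler_nat.
Qed.

Lemma slope_left_subgradient g n x : a < x <= b -> is_subgradient a b h x g ->
  slope a n x <= g.
Proof.
move=> /andP[ax xb] hg.
have [|e [e0 e1 E]] := @interior_point x a n; first by rewrite lt_eqF.
rewrite /slope E.
have := hg (x + e * (a - x)); rewrite in_itv/= => /(_ ltac:(apply/andP; split; nra)).
move=> H; rewrite ler_ndivrMr; nra.
Qed.

Lemma slope_right_subgradient g n x : a <= x < b -> is_subgradient a b h x g ->
  g <= slope b n x.
Proof.
move=> /andP[ax xb] hg.
have [|e [e0 e1 E]] := @interior_point x b n; first by rewrite gt_eqF.
rewrite /slope E.
have := hg (x + e * (b - x)); rewrite in_itv/= => /(_ ltac:(apply/andP; split; nra)).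
move=> H; rewrite ler_pdivlMr; nra.
Qed.

Lemma slope_left_le n x y : a < x -> x < y <= b ->
  slope a n x * (y - x) <= h y - h x.
Proof.
move=> ax /andP[xy yb].
have [|e [e0 e1 E]] := @interior_point x a n; first by rewrite lt_eqF.
rewrite /slope E.
have := @convex_function_slopes (x + e * (a - x)) x y.
move=> /(_ ltac:(nra) ltac:(nra) xy yb) H.
rewrite mulrAC ler_ndivrMr; nra.
Qed.

Lemma slope_right_ge n x y : a <= y < x -> x < b ->
  h x - h y <= slope b n x * (x - y).
Proof.
move=> /andP[ay yx] xb.
have [|e [e0 e1 E]] := @interior_point x b n; first by rewrite gt_eqF.
rewrite /slope E.
have := @convex_function_slopes y x (x + e * (b - x)).
move=> /(_ ay yx ltac:(nra) ltac:(nra)) H.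
rewrite mulrAC ler_pdivlMr; nra.
Qed.

Lemma left_slope_ub x : a < x < b -> has_ubound (range (slope a ^~ x)).
Proof.
move=> /andP[ax xb]; exists ((h b - h x) / (b - x)) => _ [n _ <-].
by rewrite ler_pdivlMr ?subr_gt0// slope_left_le// xb/=.
Qed.

Lemma right_slope_lb x : a < x < b -> has_lbound (range (slope b ^~ x)).
Proof.
move=> /andP[ax xb]; exists ((h x - h a) / (x - a)) => _ [n _ <-].
by rewrite ler_pdivrMr ?subr_gt0// slope_right_ge// ax lexx.
Qed.

(** To the right of [x] every left quotient is below the chord slope. To the left, quotients
    increase as the sample point approaches [x], so some sampled one exceeds the chord slope from
    [y]. *)
Lemma left_slope_subgradient x : a < x < b -> is_subgradient a b h x (left_slope x).
Proof.
move=> axb y; rewrite in_itv/= => /andP[ay yb]; have /andP[ax xb] := axb.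
have ub := left_slope_ub axb.
have [xy|yx|->] := ltgtP x y; last by rewrite subrr mulr0 addr0.
- suff : left_slope x <= (h y - h x) / (y - x).
    by rewrite ler_pdivlMr ?subr_gt0// => H; lra.
  apply: ge_sup; first by exists (slope a 0 x), 0%N.
  move=> _ [n _ <-]; rewrite ler_pdivlMr ?subr_gt0//.
  by rewrite slope_left_le// xy.
(* For this [n] the sample point lies between [y] and [x]. *)
- have [n Hn] : exists n : nat, (x - a) / n.+1%:R <= x - y.
    by apply: small_fraction; rewrite subr_gt0.
  suff : (h x - h y) / (x - y) <= slope a n x.
    move=> H; have : (h x - h y) / (x - y) <= left_slope x.
      by apply: (le_trans H); apply: ub_le_sup => //; exists n.
    by rewrite ler_pdivrMr ?subr_gt0// => {}H; lra.
  have [|e [e0 e1 E]] := @interior_point x a n; first by rewrite lt_eqF.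
  rewrite -(opprB a x) mulNr E -mulrN opprB in Hn.
  rewrite /slope E ler_pdivrMr ?subr_gt0//.
  rewrite mulrAC ler_ndivlMr; last by nra.
  have [->|ne] := eqVneq y (x + e * (a - x)); first by nra.
  have := @convex_function_slopes y (x + e * (a - x)) x.
  have : y < x + e * (a - x) by rewrite lt_neqAle ne/=; lra.
  by move=> H /(_ ay H ltac:(nra) (ltW xb)); nra.
Qed.

Lemma right_slope_subgradient x : a < x < b -> is_subgradient a b h x (right_slope x).
Proof.
move=> axb y; rewrite in_itv/= => /andP[ay yb]; have /andP[ax xb] := axb.
have lb := right_slope_lb axb.
have [xy|yx|->] := ltgtP x y; last by rewrite subrr mulr0 addr0.
- have [n Hn] : exists n : nat, (b - x) / n.+1%:R <= y - x.
    by apply: small_fraction; rewrite subr_gt0.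
  suff : slope b n x <= (h y - h x) / (y - x).
    move=> H; have : right_slope x <= (h y - h x) / (y - x).
      by apply: le_trans H; apply: ge_inf => //; exists n.
    by rewrite ler_pdivlMr ?subr_gt0// => {}H; lra.
  have [|e [e0 e1 E]] := @interior_point x b n; first by rewrite gt_eqF.
  rewrite E in Hn.
  rewrite /slope E ler_pdivlMr ?subr_gt0//.
  rewrite mulrAC ler_pdivrMr; last by nra.
  have [->|ne] := eqVneq y (x + e * (b - x)); first by nra.
  have := @convex_function_slopes x (x + e * (b - x)) y.
  have : x + e * (b - x) < y by rewrite lt_neqAle eq_sym ne/=; lra.
  by move=> H /(_ (ltW ax) ltac:(nra) H yb); nra.
- suff : (h x - h y) / (x - y) <= right_slope x.
    by rewrite ler_pdivrMr ?subr_gt0// => H; lra.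
  apply: lb_le_inf; first by exists (slope b 0 x), 0%N.
  move=> _ [n _ <-]; rewrite ler_pdivrMr ?subr_gt0//.
  by rewrite slope_right_ge// ay.
Qed.

(** Together with [left_slope_subgradient], this makes [left_slope] the least subgradient at an
    interior point; symmetrically [right_slope] is the greatest. *)
Lemma left_slope_le g x : a < x < b -> is_subgradient a b h x g ->
  left_slope x <= g.
Proof.
move=> /andP[ax xb] hg; apply: ge_sup; first by exists (slope a 0 x), 0%N.
by move=> _ [n _ <-]; apply: slope_left_subgradient => //; rewrite ax ltW.
Qed.

Lemma right_slope_ge g x : a < x < b -> is_subgradient a b h x g ->
  g <= right_slope x.
Proof.
move=> /andP[ax xb] hg; apply: lb_le_inf; first by exists (slope b 0 x), 0%N.
by move=> _ [n _ <-]; apply: slope_right_subgradient => //; rewrite ltW.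
Qed.

(** By convexity the quotient over a fraction [s] of the way from [x] to [y] is at most the full
    increment, while for small [s] it is within [e] of the derivative term. *)
Lemma derive1_subgradient x : a < x < b -> derivable h x 1 ->
  is_subgradient a b h x (derive1 h x).
Proof.
move=> /andP[ax xb] dh y; rewrite in_itv/= => /andP[ay yb].
have [->|yx] := eqVneq y x; first by rewrite subrr mulr0 addr0.
apply/ler_addgt0Pr => e e0.
have d0 : 0 < `|y - x| by rewrite normr_gt0 subr_eq0.
have /cvgrPdist_lt /(_ (e / `|y - x|)) :
    t^-1 *: (h (t + x) - h x) @[t --> (0 : R)^'] --> derive1 h x.
  have := dh; rewrite /derivable/= (_ : (fun t => _) = (fun t => t^-1 *: (h (t + x) - h x)))//.
  by apply/funext => t; rewrite /GRing.scale/= mulr1.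
move=> /(_ (divr_gt0 e0 d0)); rewrite near_withinE /= => -[r /= r0 Hr].
(* [s] must be a convex weight and put the step strictly inside the ball of radius [r], hence the
   cap at 1 and the factor 1/2. *)
pose s := Num.min (r / 2 / `|y - x|) 1.
have s0 : 0 < s by rewrite lt_min ltr01 !divr_gt0.
have s1 : s <= 1 by rewrite ge_min lexx orbT.
have sr : s * `|y - x| < r.
  have : s <= r / 2 / `|y - x| by rewrite ge_min lexx.
  by rewrite ler_pdivlMr// => H; lra.
have := Hr (s * (y - x)).
rewrite /ball/= sub0r normrN normrM (gtr0_norm s0) => /(_ sr).
have sy0 : s * (y - x) != 0 by rewrite mulf_neq0 ?subr_eq0 ?lt0r_neq0.
move=> /(_ sy0).
have -> : s * (y - x) + x = s * y + (1 - s) * x by ring.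
have := convex_function_ineq (x := y) (y := x) (ltW s0) s1.
rewrite !in_itv/= ay yb (ltW ax) (ltW xb) => /(_ isT isT).
set H := h (s * y + _) => conv.
rewrite ltr_pdivlMr// -normrM => /ltr_normlP[_].
rewrite mulrBl /GRing.scale/= invfM mulrAC -(mulrA s^-1) mulVf ?subr_eq0// mulr1.
have : s^-1 * (H - h x) <= h y - h x by rewrite mulrC ler_pdivrMr//; lra.
lra.
Qed.

(** At an interior point a subgradient always exists, [left_slope] being one, so the conditional
    clause of the selection applies wherever [h] is not differentiable. *)
Lemma derivative_selection_subgradient dh x : is_derivative_selection a b h dh ->
  a < x < b -> is_subgradient a b h x (dh x).
Proof.
move=> hdh axb; have /andP[ax xb] := axb.
have [|d1 d2] := hdh x; first by rewrite in_itv/= !ltW.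
have [dx|ndx] := pselect (derivable h x 1).
  by rewrite d1//; exact: derive1_subgradient.
apply: d2; first by case.
by exists (left_slope x); exact: left_slope_subgradient.
Qed.

End convex_on_interval.

(** * The envelope formula *)

(* Halving [c, d] halves the factor y - x, while the increments of m telescope. *)
Lemma increment_le0 (R : realType) (Phi m : R -> R) (K c d : R) : c <= d -> 0 <= K ->
  (forall x y, c <= x -> x <= y -> y <= d ->
    Phi y - Phi x <= K * (y - x) * (m y - m x)) ->
  Phi d <= Phi c.
Proof.
move=> cd K0 H.
have halve N : forall x y, c <= x -> x <= y -> y <= d ->
    2 ^+ N * (Phi y - Phi x) <= K * (y - x) * (m y - m x).
  elim: N => [|N IH] x y cx xy yd; first by rewrite expr0 mul1r H.
  pose z := (x + y) / 2.
  have zx : z - x = (y - x) / 2 by rewrite /z; field.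
  have yz : y - z = (y - x) / 2 by rewrite /z; field.
  have := IH x z cx ltac:(lra) ltac:(lra).
  have := IH z y ltac:(lra) ltac:(lra) yd.
  by rewrite exprS zx yz; lra.
(* A positive increment times [2 ^+ N] would stay below a fixed bound for all [N], against the
   Archimedean property. *)
rewrite leNgt; apply/negP => lt; have D0 : 0 < Phi d - Phi c by lra.
have := archi_boundP (normr_ge0 (K * (d - c) * (m d - m c) / (Phi d - Phi c))).
set n := Num.bound _ => Hn.
have n2 : n%:R <= 2 ^+ n :> R by rewrite -natrX ler_nat ltnW// ltn_expl.
have := halve n c d (lexx _) cd (lexx _).
rewrite -ler_pdivlMr// => /(le_trans n2).
by move=> /(lt_le_trans (le_lt_trans (ler_norm _) Hn)); rewrite ltxx.
Qed.

(** * Integrals over closed intervals *)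

Section interval_integrals.
Context (R : realType).
Implicit Types (x y z c d : R) (k : R -> \bar R).
Local Notation mu := (@lebesgue_measure R).
Local Open Scope ereal_scope.

Lemma ge0_integral_itvcc_split k x y z : (x <= y)%R -> (y <= z)%R ->
  measurable_fun `[x, z] k -> (forall t, t \in `[x, z] -> 0 <= k t) ->
  \int[mu]_(t in `[x, z]) k t =
  \int[mu]_(t in `[x, y]) k t + \int[mu]_(t in `[y, z]) k t.
Proof.
move=> xy yz mk k0.
rewrite (@itv_bndbnd_setU _ _ (BLeft x) (BRight y) (BRight z)) ?bnd_simp//.
rewrite ge0_integral_setU//.
- rewrite integral_itv_obnd_cbnd//.
  by apply: measurable_funS mk => //; apply: subset_itv; rewrite bnd_simp.
- by rewrite -itv_bndbnd_setU ?bnd_simp.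
- by rewrite -itv_bndbnd_setU ?bnd_simp.
- apply/disj_setPS => t [/=]; rewrite !in_itv/= => /andP[_ ty] /andP[].
  by rewrite ltNge ty.
Qed.

Lemma ge0_integral_itvcc_sub k c d x y : (c <= x)%R -> (y <= d)%R ->
  measurable_fun `[c, d] k -> (forall t, t \in `[c, d] -> 0 <= k t) ->
  \int[mu]_(t in `[x, y]) k t <= \int[mu]_(t in `[c, d]) k t.
Proof.
move=> cx yd mk k0; apply: ge0_subset_integral => //.
by apply: subset_itv; rewrite bnd_simp.
Qed.

Lemma integral_cst_itvcc x y (r : R) : (x <= y)%R ->
  \int[mu]_(t in `[x, y]) r%:E = (r * (y - x))%:E.
Proof.
move=> xy; rewrite integral_cst//= lebesgue_measure_itv/= lte_fin.
have [//|yx] := ltP x y; have -> : x = y by apply/eqP; rewrite eq_le xy.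
by rewrite mule0 subrr mulr0.
Qed.

(** Subgradients are controlled only at interior points. Monotone convergence along closed intervals
    exhausting the open one carries a bound to the whole interval, whose end points are null. *)
Lemma integral_itvcc_le_interior k c d (M : \bar R) : (c < d)%R ->
  measurable_fun `[c, d] k -> (forall t, t \in `[c, d] -> 0 <= k t) ->
  (forall x y, (c < x)%R -> (x <= y)%R -> (y < d)%R ->
    \int[mu]_(t in `[x, y]) k t <= M) ->
  \int[mu]_(t in `[c, d]) k t <= M.
Proof.
move=> cd mk k0 H.
(* With [n.+2] each [e n] is at most half the length, so the end points of [F n] never cross. *)
pose e n : R := ((d - c) / n.+2%:R)%R.
have e0 n : (0 < e n)%R by rewrite divr_gt0// subr_gt0.
have eh n : (e n <= (d - c) / 2)%R.
  by rewrite ler_pM2l ?subr_gt0// lef_pV2 ?posrE// ler_nat.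
have edec n n' : (n <= n')%N -> (e n' <= e n)%R.
  by move=> nn; rewrite ler_pM2l ?subr_gt0// lef_pV2 ?posrE// ler_nat.
pose F n : set R := [set` `[(c + e n)%R, (d - e n)%R]].
have sF n : F n `<=` `[c, d].
  by apply: subset_itv; rewrite bnd_simp; have := e0 n; lra.
have UF : \bigcup_n F n = `]c, d[%classic.
  apply/seteqP; split=> [t [n _]|t]; rewrite /F /= !in_itv/=.
    by have := e0 n => en /andP[? ?]; apply/andP; split; lra.
  move=> /andP[ct td]; pose r := (Num.min (t - c) (d - t))%R.
  have r0 : (0 < r)%R by rewrite lt_min !subr_gt0 ct.
  have := archi_boundP (ltW (divr_gt0 (etrans (subr_gt0 c d) cd) r0)).
  set n := Num.bound _ => Hn; exists n => //=; rewrite in_itv/=.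
  have er : (e n <= r)%R.
    rewrite ler_pdivrMr// mulrC -ler_pdivrMr// (le_trans (ltW Hn))//.
    by rewrite ler_nat ltnW// leqW.
  have : (r <= t - c)%R by rewrite ge_min lexx.
  have : (r <= d - t)%R by rewrite ge_min lexx orbT.
  by move=> ? ?; apply/andP; split; lra.
have mo : measurable_fun `]c, d[ k.
  by apply: measurable_funS mk => //; apply: subset_itv; rewrite bnd_simp.
rewrite integral_itv_bndoo// -UF.
have cv : \int[mu]_(t in F n) k t @[n --> \oo] --> \int[mu]_(t in \bigcup_n F n) k t.
  apply: ge0_nondecreasing_set_cvg_integral.
  - move=> n n' nn; apply/subsetPset; apply: subset_itv; rewrite bnd_simp;
    have := edec _ _ nn; lra.
  - by move=> n; exact: measurable_itv.
  - by move=> n; apply: measurable_funS mk.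
  - by move=> n t /sF; exact: k0.
rewrite -(cvg_lim _ cv)//.
apply: lime_le; first by apply/cvg_ex; eexists; exact: cv.
by apply: nearW => n; apply: H; have := e0 n; have := eh n; lra.
Qed.

End interval_integrals.

(** * Integrating subgradients, and allocations against subgradients *)

Section envelope.
Context (R : realType) (a b : R) (h g : R -> R).
Local Notation mu := (@lebesgue_measure R).
Hypotheses (h_cont : {within `[a, b], continuous h})
  (h_mono : {in `[a, b] &, {homo h : x y / x <= y}})
  (g_meas : measurable_fun `[a, b] g)
  (g_ge0 : forall x, x \in `[a, b] -> 0 <= g x)
  (g_sub : forall x, a < x < b -> is_subgradient a b h x (g x)).

Let h_le x y : a <= x -> x <= y -> y <= b -> h x <= h y.
Proof. by move=> ax xy yb; apply: h_mono; rewrite ?in_itv/=; lra. Qed.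

Let h_cont_sub c d : a <= c -> d <= b -> {within `[c, d], continuous h}.
Proof.
move=> ac db; apply: continuous_subspaceW h_cont.
by apply: subset_itv; rewrite bnd_simp.
Qed.

Let g_increment x y : a < x -> x <= y -> y < b -> h y - h x <= g y * (y - x).
Proof.
move=> ax xy yb; have := @g_sub y; rewrite yb (lt_le_trans ax xy) => /(_ isT x).
by rewrite in_itv/= => /(_ ltac:(lra)); lra.
Qed.

Let g_increment_ge x y : a < x -> x <= y -> y < b -> g x * (y - x) <= h y - h x.
Proof.
move=> ax xy yb; have := @g_sub x; rewrite ax (le_lt_trans xy yb) => /(_ isT y).
by rewrite in_itv/= => /(_ ltac:(lra)); lra.
Qed.

Let g_homo x y : a < x -> x <= y -> y < b -> g x <= g y.
Proof.
move=> ax; rewrite le_eqVlt => /predU1P[->//|xy] yb.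
have := le_trans (g_increment_ge ax (ltW xy) yb) (g_increment ax (ltW xy) yb).
by rewrite ler_pM2r ?subr_gt0.
Qed.

Let mE (k : R -> R) c d : a <= c -> d <= b -> measurable_fun `[a, b] k ->
  measurable_fun `[c, d] (EFin \o k).
Proof.
move=> ac db mk; apply/measurable_EFinP; apply: measurable_funS mk => //.
by apply: subset_itv; rewrite bnd_simp.
Qed.

Let g_bounds x y : a < x -> x <= y -> y < b ->
  ((g x * (y - x))%:E <= \int[mu]_(t in `[x, y]) (g t)%:E <= (g y * (y - x))%:E)%E.
Proof.
move=> ax xy yb; rewrite -!integral_cst_itvcc//; apply/andP; split.
  apply: ge0_le_integral => //.
  - by move=> t; rewrite lee_fin g_ge0// in_itv/=; lra.
  - by apply: mE => //; lra.
  - by move=> t /=; rewrite in_itv/= lee_fin => ?; apply: g_homo; lra.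
apply: ge0_le_integral => //.
- by move=> t /=; rewrite in_itv/= lee_fin => ?; apply: g_ge0; rewrite in_itv/=; lra.
- by apply: mE => //; lra.
- by move=> t /=; rewrite in_itv/= lee_fin => ?; apply: g_homo; lra.
Qed.

(** The increments of [h] and of the integral both lie between [g x * (y - x)] and [g y * (y - x)].
    Hence [increment_le0] with [m = g] and [K = 1] applies to their difference in both
    directions. *)
Lemma integral_subgradient_interior c d : a < c -> c <= d -> d < b ->
  (\int[mu]_(t in `[c, d]) (g t)%:E = (h d - h c)%:E)%E.
Proof.
move=> ac cd db.
pose I x := fine (\int[mu]_(t in `[c, x]) (g t)%:E)%E.
have fI x y : c <= x -> x <= y -> y <= d ->
    (\int[mu]_(t in `[x, y]) (g t)%:E)%E \is a fin_num.
  move=> cx xy yd; have /andP[lo hi] := g_bounds (lt_le_trans ac cx) xy (le_lt_trans yd db).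
  by rewrite fin_numE -ltey -ltNye (lt_le_trans _ lo) ?(le_lt_trans hi) ?ltry ?ltNyr.
have dI x y : c <= x -> x <= y -> y <= d ->
    I y - I x = fine (\int[mu]_(t in `[x, y]) (g t)%:E)%E.
  move=> cx xy yd; rewrite /I (@ge0_integral_itvcc_split _ _ c x y)//.
  - by rewrite fineD ?fI ?lexx//; [lra|lra].
  - by apply: mE => //; lra.
  - by move=> t; rewrite in_itv/= lee_fin => ?; apply: g_ge0; rewrite in_itv/=; lra.
have Ib x y : c <= x -> x <= y -> y <= d ->
    g x * (y - x) <= I y - I x <= g y * (y - x).
  move=> cx xy yd.
  have /andP[lo hi] := g_bounds (lt_le_trans ac cx) xy (le_lt_trans yd db).
  by rewrite dI//; apply/andP; split; rewrite -lee_fin fineK ?fI.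
have Ic : I c = 0 by rewrite /I set_itv1 integral_set1.
suff E : I d = h d - h c by rewrite -E /I fineK// fI.
apply/eqP; rewrite eq_le; apply/andP; split.
  have := @increment_le0 R (fun x => I x - h x) g 1 c d cd ler01.
  have H x y : c <= x -> x <= y -> y <= d ->
      I y - h y - (I x - h x) <= 1 * (y - x) * (g y - g x).
    move=> cx xy yd; have /andP[_ hi] := Ib _ _ cx xy yd.
    by have := g_increment_ge (lt_le_trans ac cx) xy (le_lt_trans yd db); lra.
  by move=> /(_ H); lra.
have := @increment_le0 R (fun x => h x - I x) g 1 c d cd ler01.
have H x y : c <= x -> x <= y -> y <= d ->
    h y - I y - (h x - I x) <= 1 * (y - x) * (g y - g x).
  move=> cx xy yd; have /andP[lo _] := Ib _ _ cx xy yd.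
  by have := g_increment (lt_le_trans ac cx) xy (le_lt_trans yd db); lra.
by move=> /(_ H); lra.
Qed.

(** The upper bound passes from interior intervals to the closed one. The lower bound uses
    continuity: interior points near [c] and [d] lose less than [e / 2] each. *)
Lemma integral_subgradient c d : a <= c -> c <= d -> d <= b ->
  (\int[mu]_(t in `[c, d]) (g t)%:E = (h d - h c)%:E)%E.
Proof.
move=> ac; rewrite le_eqVlt => /predU1P[->|cd] db.
  by rewrite set_itv1 integral_set1 subrr.
have mg : measurable_fun `[c, d] (EFin \o g) by apply: mE.
have g0 t : t \in `[c, d] -> (0 <= (g t)%:E)%E.
  by rewrite in_itv/= lee_fin => ?; apply: g_ge0; rewrite in_itv/=; lra.
apply/eqP; rewrite eq_le; apply/andP; split.
  apply: integral_itvcc_le_interior => // x y cx xy yd.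
  rewrite integral_subgradient_interior//; [|lra|lra].
  by rewrite lee_fin lerB// h_le//; lra.
apply/lee_addgt0Pr => e e0.
have [_ hc hd] := (continuous_within_itvP h cd).1 (h_cont_sub ac db).
have e2 : 0 < e / 2 by lra.
(* The midpoint keeps the two approximating points in order. *)
pose m := (c + d) / 2.
have [x [xe cx xm]] : exists x, [/\ h x - h c < e / 2, c < x & x < m].
  have : \forall x \near c^'+,
      (`|h c - h x| < e / 2 /\ x < m) /\ c < x.
    near=> x; split; first split; near: x.
    - by move/cvgrPdist_lt : hc; apply.
    - by apply: nbhs_right_lt; rewrite /m; lra.
    - exact: nbhs_right_gt.
  move=> H; have [x [[xe xm] cx]] := @filter_ex _ _ (at_right_proper_filter c) _ H.
  by exists x; split => //; move: xe; rewrite ltr_norml; lra.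
have [y [ye my yd]] : exists y, [/\ h d - h y < e / 2, m < y & y < d].
  have : \forall y \near d^'-,
      (`|h d - h y| < e / 2 /\ m < y) /\ y < d.
    near=> y; split; first split; near: y.
    - by move/cvgrPdist_lt : hd; apply.
    - by apply: nbhs_left_gt; rewrite /m; lra.
    - exact: nbhs_left_lt.
  move=> H; have [y [[ye my] yd]] := @filter_ex _ _ (at_left_proper_filter d) _ H.
  by exists y; split => //; move: ye; rewrite ltr_norml; lra.
have := @ge0_integral_itvcc_sub _ (EFin \o g) c d x y (ltW cx) (ltW yd) mg g0.
rewrite /= (@integral_subgradient_interior x y); [|lra|lra|lra].
move=> /(leeD2r e%:E); apply: le_trans.
by rewrite -EFinD lee_fin; lra.
Unshelve. all: by end_near. Qed.

Context (q : R -> R).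
(** [q_mono] is eventual monotonicity expressed through [h]: being past the initial plateau of [h]
    means [h a < h y]. *)
Hypotheses (q_meas : measurable_fun `[a, b] q)
  (q01 : forall x, x \in `[a, b] -> 0 <= q x <= 1)
  (q_mono : forall x y, a <= x -> x <= y -> y <= b -> h a < h y -> q x <= q y).

Let qg_ge0 c d : a <= c -> d <= b ->
  forall t, t \in `[c, d] -> (0 <= (q t * g t)%:E)%E.
Proof.
move=> ac db t; rewrite in_itv/= lee_fin => tcd.
have tab : t \in `[a, b] by rewrite in_itv/=; lra.
by rewrite mulr_ge0 ?g_ge0//; have /andP[] := q01 tab.
Qed.

Let qg_meas c d : a <= c -> d <= b ->
  measurable_fun `[c, d] (fun t => (q t * g t)%:E).
Proof. by move=> ac db; apply: (@mE (fun t => q t * g t)) => //; exact: measurable_funM. Qed.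

Let integral_cstM c d r : a <= c -> c <= d -> d <= b -> 0 <= r ->
  (\int[mu]_(t in `[c, d]) (r * g t)%:E = (r * (h d - h c))%:E)%E.
Proof.
move=> ac cd db r0; under eq_integral do rewrite EFinM.
rewrite ge0_integralZl_EFin//; first by rewrite integral_subgradient.
- by move=> t; rewrite /= in_itv/= lee_fin => ?; apply: g_ge0; rewrite in_itv/=; lra.
- exact: mE.
Qed.

(** Past the plateau, [q t <= q y] for all [t <= y]. On the plateau, [g] integrates to 0 and so does
    [q * g], since [q <= 1]. *)
Lemma integral_allocation_le x y : a <= x -> x <= y -> y <= b ->
  (\int[mu]_(t in `[x, y]) (q t * g t)%:E <= (q y * (h y - h x))%:E)%E.
Proof.
move=> ax xy yb.
have [hya|hay] := eqVneq (h y) (h a).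
  have -> : h x = h y by have := h_le ax xy yb; have := h_le (lexx a) ax (le_trans xy yb); lra.
  rewrite subrr mulr0.
  apply: (@le_trans _ _ (\int[mu]_(t in `[x, y]) (g t)%:E)%E).
    apply: ge0_le_integral => //.
    - by move=> t; apply: qg_ge0.
    - exact: qg_meas.
    - exact: mE.
    - move=> t /=; rewrite in_itv/= lee_fin => txy.
      have tab : t \in `[a, b] by rewrite in_itv/=; lra.
      by rewrite ler_piMl ?g_ge0//; have /andP[] := q01 tab.
  rewrite integral_subgradient// lee_fin.
  by have := h_le (lexx a) ax (le_trans xy yb); lra.
have {}hay : h a < h y by rewrite lt_neqAle eq_sym hay h_le//; lra.
have yab : y \in `[a, b] by rewrite in_itv/=; lra.
rewrite -integral_cstM//; last by have /andP[] := q01 yab.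
apply: ge0_le_integral => //.
- by move=> t; apply: qg_ge0.
- exact: qg_meas.
- apply: (@mE (fun t => q y * g t)) => //; exact: measurable_funM.
- move=> t /=; rewrite in_itv/= lee_fin => txy.
  rewrite ler_wpM2r ?g_ge0//; first by rewrite in_itv/=; lra.
  by apply: q_mono => //; lra.
Qed.

(** The comparison [q x <= q t] holds only for [t] past the plateau. It is therefore applied on
    [m, y] with [h a < h m], and the piece [x, m] is dropped. *)
Lemma integral_allocation_ge x y : a <= x -> x <= y -> y <= b ->
  ((q x * (h y - h x))%:E <= \int[mu]_(t in `[x, y]) (q t * g t)%:E)%E.
Proof.
move=> ax xy yb.
have xab : x \in `[a, b] by rewrite in_itv/=; lra.
have qx := q01 xab.
have from m : x <= m -> m <= y -> h a < h m ->
    ((q x * (h y - h m))%:E <= \int[mu]_(t in `[x, y]) (q t * g t)%:E)%E.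
  move=> xm my ham; rewrite -integral_cstM//; [|lra|lra].
  apply: le_trans (@ge0_integral_itvcc_sub _ (fun t => (q t * g t)%:E) x y m y
    xm (lexx y) (qg_meas ax yb) (qg_ge0 ax yb)).
  apply: ge0_le_integral => //.
  - move=> t /=; rewrite in_itv/= lee_fin => tmy.
    by rewrite mulr_ge0 ?g_ge0//; [lra|rewrite in_itv/=; lra].
  - by apply: (@mE (fun t => q x * g t)); [lra|lra|exact: measurable_funM].
  - by apply: qg_meas; lra.
  - move=> t /=; rewrite in_itv/= lee_fin => tmy.
    rewrite ler_wpM2r ?g_ge0//; first by rewrite in_itv/=; lra.
    apply: q_mono; [lra|lra|lra|].
    by apply: (lt_le_trans ham); apply: h_le; lra.
have [hxa|hax] := eqVneq (h x) (h a); last first.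
  by apply: from => //; rewrite lt_neqAle eq_sym hax h_le//; lra.
have hxy := h_le ax xy yb.
have [<-|hyx] := eqVneq (h x) (h y).
  by rewrite subrr mulr0; apply: integral_ge0 => t; exact: qg_ge0.
apply/lee_addgt0Pr => e e0.
(* If [x] lies on the plateau, the intermediate value theorem gives [m] just past it; the dropped
   piece costs at most [e] because [q x <= 1]. *)
pose w := Num.min (h y) (h x + e).
have [m mxy hm] : exists2 m, m \in `[x, y] & h m = w.
  apply: IVT => //; first exact: h_cont_sub.
  rewrite min_l// max_r// /w le_min ge_min hxy lexx/=; lra.
move: mxy; rewrite in_itv/= => /andP[xm my].
have ham : h a < h m.
  by rewrite hm -hxa /w lt_min; apply/andP; split; [rewrite lt_neqAle hyx|lra].
have := from m xm my ham => /(leeD2r e%:E); apply: le_trans.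
rewrite -EFinD lee_fin.
have : w <= h x + e by rewrite ge_min lexx orbT.
by rewrite hm; nra.
Qed.

(** From [y] to [z] the payoff grows by at least [q y * (h z - h y)] and the rent by at most
    [q z * (h z - h y)]. The gap is bounded by a constant times [z - y] times a telescoping
    increment, so [increment_le0] applies on interior intervals. *)
Lemma integral_allocation_le_payoff (u : R -> R) x :
  (forall y, y \in `[a, b] -> 0 <= u y) ->
  (forall y z, y \in `[a, b] -> z \in `[a, b] ->
    u z + (h y - h z) * q z <= u y) ->
  a <= x -> x <= b ->
  (\int[mu]_(t in `[a, x]) (q t * g t)%:E <= (u x)%:E)%E.
Proof.
move=> u0 ic; rewrite le_eqVlt => /predU1P[<-|ax] xb.
  by rewrite set_itv1 integral_set1 lee_fin u0// in_itv/=; lra.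
have u_le y z : a <= y -> y <= z -> z <= b -> u y <= u z.
  move=> ay yz zb; have yab : y \in `[a, b] by rewrite in_itv/=; lra.
  have zab : z \in `[a, b] by rewrite in_itv/=; lra.
  have := ic z y zab yab; have := h_le ay yz zb; have := q01 yab; nra.
apply: integral_itvcc_le_interior => //.
- by apply: qg_meas => //; lra.
- by apply: qg_ge0 => //; lra.
move=> c d ac cd dx; have db : d < b by lra.
pose I y := fine (\int[mu]_(t in `[c, y]) (q t * g t)%:E)%E.
have fI y z : c <= y -> y <= z -> z <= d ->
    (\int[mu]_(t in `[y, z]) (q t * g t)%:E)%E \is a fin_num.
  move=> cy yz zd; rewrite fin_numE -ltey -ltNye (lt_le_trans (ltNyr 0)) ?integral_ge0//.
    by rewrite (le_lt_trans (integral_allocation_le _ _ _))// ?ltry//; lra.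
  by apply: qg_ge0; lra.
have dI y z : c <= y -> y <= z -> z <= d ->
    I z - I y = fine (\int[mu]_(t in `[y, z]) (q t * g t)%:E)%E.
  move=> cy yz zd; rewrite /I (@ge0_integral_itvcc_split _ _ c y z)//.
  - by rewrite fineD ?fI ?lexx//; [lra|lra].
  - by apply: qg_meas; lra.
  - by apply: qg_ge0; lra.
have Ib y z : c <= y -> y <= z -> z <= d -> I z - I y <= q z * (h z - h y).
  move=> cy yz zd; rewrite dI// -lee_fin fineK ?fI//.
  by apply: integral_allocation_le => //; lra.
have Ic : I c = 0 by rewrite /I set_itv1 integral_set1.
(* On the plateau [q] may decrease; setting it to 0 there restores monotonicity. The factor [g d]
   below is a Lipschitz constant of [h] on [c, d], available since [d < b]. *)
pose m y := if h a < h y then q y else 0.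
have step y z : c <= y -> y <= z -> z <= d ->
    I z - u z - (I y - u y) <= g d * (z - y) * (m z - m y).
  move=> cy yz zd.
  have yab : y \in `[a, b] by rewrite in_itv/=; lra.
  have zab : z \in `[a, b] by rewrite in_itv/=; lra.
  have /andP[qy0 _] := q01 yab; have /andP[qz0 _] := q01 zab.
  have Iyz := Ib _ _ cy yz zd; have uyz := ic z y zab yab.
  have hay : h a <= h y by apply: h_le; lra.
  have hyz : h y <= h z by apply: h_le; lra.
  have hK : h z - h y <= g d * (z - y).
    apply: le_trans (g_increment _ yz _) _; [lra|lra|].
    by rewrite ler_wpM2r ?subr_ge0// g_homo//; lra.
  have K0 : 0 <= g d * (z - y).
    by rewrite mulr_ge0 ?subr_ge0// g_ge0// in_itv/=; lra.
  rewrite /m; case: ifPn => [haz|]; last first.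
    rewrite -leNgt => hza; have E : h z = h y by lra.
    by rewrite ifF; [rewrite E subrr in Iyz uyz; lra|apply/negbTE; rewrite -leNgt; lra].
  have qyz : q y <= q z by apply: q_mono => //; lra.
  by case: ifPn => [_|]; [nra|rewrite -leNgt => ?; nra].
(* This yields [I d <= u d - u c]; then [0 <= u c] and the monotonicity of [u] bound it by [u x]. *)
have := @increment_le0 R (fun y => I y - u y) m (g d) c d cd.
have gd0 : 0 <= g d by apply: g_ge0; rewrite in_itv/=; lra.
move=> /(_ gd0 step); rewrite Ic => H.
rewrite -(fineK (fI c d (lexx _) cd (lexx _))) lee_fin -/(I d).
have cab : c \in `[a, b] by rewrite in_itv/=; lra.
have := u0 c cab; have : u d <= u x by apply: u_le; lra.
by lra.
Qed.

End envelope.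

(** * Signal profiles *)

Section profiles.
Context (R : realType).

Definition others (n : nat) (i : 'I_n) (s : n.-tuple R) : n.-1.-tuple R :=
  [tuple tnth s (lift i k) | k < n.-1].

Lemma tnth_profile n (i : 'I_n) (x : R) (t : n.-1.-tuple R) : tnth (profile i x t) i = x.
Proof. by rewrite tnth_mktuple unlift_none. Qed.

Lemma tnth_profile_lift n (i : 'I_n) (x : R) (t : n.-1.-tuple R) k :
  tnth (profile i x t) (lift i k) = tnth t k.
Proof. by rewrite tnth_mktuple liftK. Qed.

Lemma others_profile n (i : 'I_n) (x : R) (t : n.-1.-tuple R) :
  others i (profile i x t) = t.
Proof. by apply: eq_from_tnth => k; rewrite tnth_mktuple tnth_profile_lift. Qed.

Lemma profile_others n (i : 'I_n) (s : n.-tuple R) :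
  profile i (tnth s i) (others i s) = s.
Proof.
apply: eq_from_tnth => j; rewrite tnth_mktuple.
by case: unliftP => [k ->|->//]; rewrite tnth_mktuple.
Qed.

Lemma cube_profile (a b : R) n (i : 'I_n) (x : R) (t : n.-1.-tuple R) :
  cube a b (profile i x t) <-> x \in `[a, b] /\ cube a b t.
Proof.
split=> [H|[xab H] j].
  split; first by have := H i; rewrite tnth_profile.
  by move=> k; have := H (lift i k); rewrite tnth_profile_lift.
by case: (unliftP i j) => [k ->|->]; rewrite ?tnth_profile_lift ?tnth_profile.
Qed.

Lemma cube_others (a b : R) n (i : 'I_n) (s : n.-tuple R) : cube a b s ->
  tnth s i \in `[a, b] /\ cube a b (others i s).
Proof. by rewrite -{1}(profile_others i s) => /cube_profile. Qed.

Lemma joint_profile n (i : 'I_n) (f : R -> R) (x : R) (t : n.-1.-tuple R) :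
  joint f (profile i x t) = f x * joint f t.
Proof.
case: n i t => [[]//|n] i t; rewrite /joint (bigD1_ord i)//= tnth_profile.
by congr (_ * _); apply: eq_bigr => k _; rewrite tnth_profile_lift.
Qed.

Lemma measurable_profile n (i : 'I_n) :
  measurable_fun [set: R * n.-1.-tuple R] (fun xt => profile i xt.1 xt.2).
Proof.
apply/measurable_fun_tnthP => j.
case: (unliftP i j) => [k ->|->].
  rewrite (_ : _ \o _ = (fun t => tnth t k) \o snd); last first.
    by apply/funext => -[x t]; rewrite /= tnth_profile_lift.
  by apply: measurableT_comp => //; exact: measurable_tnth.
rewrite (_ : _ \o _ = fst)//.
by apply/funext => -[x t]; rewrite /= tnth_profile.
Qed.

Lemma measurable_others n (i : 'I_n) :
  measurable_fun [set: n.-tuple R] (others i).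
Proof.
apply/measurable_fun_tnthP => k.
rewrite (_ : _ \o _ = (fun s => tnth s (lift i k))); first exact: measurable_tnth.
by apply/funext => s; rewrite /= tnth_mktuple.
Qed.

Lemma measurable_cube (a b : R) m : measurable (@cube R a b m).
Proof.
rewrite (_ : @cube R a b m =
    \bigcap_(j in [set: 'I_m]) [set s : m.-tuple R | tnth s j \in `[a, b]]).
  apply: fin_bigcap_measurable => // j _.
  rewrite -[X in measurable X]setTI.
  exact: (measurable_tnth j _ (measurable_itv `[a, b])).
by apply/seteqP; split => s /= H j; [move=> _; exact: H|exact: H].
Qed.

End profiles.

(** * Tonelli's theorem with an arbitrary coordinate integrated first *)

Section tonelli_profile.
Context (R : realType).
Local Notation mu := (@lebesgue_measure R).
Local Notation leb := (lebesgue_tuple R).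
Local Open Scope ereal_scope.

Lemma measurable_integral_profile n (i : 'I_n) (G : n.-tuple R -> \bar R) :
  measurable_fun setT G -> (forall s, 0 <= G s) ->
  measurable_fun [set: n.-1.-tuple R] (fun t => \int[mu]_x G (profile i x t)).
Proof.
move=> mG G0.
apply: (@measurable_fun_fubini_tonelli_G _ _ _ _ _ mu
  (fun xt : measurableTypeR R * n.-1.-tuple R => G (profile i xt.1 xt.2))) => //.
by apply: measurableT_comp => //; exact: measurable_profile.
Qed.

(** Both orders are kept: integrating coordinate 0 needs it innermost, while the induction for a
    later coordinate needs it outermost. *)
Lemma integral_lebesgue_tuple_cons m (G : m.+1.-tuple R -> \bar R) :
  measurable_fun setT G -> (forall s, 0 <= G s) ->
  \int[leb m.+1]_s G s = \int[mu]_x \int[leb m]_t G (tuple_cons (x, t)) /\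
  \int[leb m.+1]_s G s = \int[leb m]_t \int[mu]_x G (tuple_cons (x, t)).
Proof.
move=> mG G0.
have mGc : measurable_fun setT (G \o @tuple_cons R m).
  by apply: measurableT_comp => //; exact: measurable_tuple_cons.
rewrite -(fubini_tonelli1 (G \o @tuple_cons R m)) => [||xt]//=.
rewrite -(fubini_tonelli2 (G \o @tuple_cons R m)) => [||xt]//=.
suff : \int[leb m.+1]_s G s = \int[mu \x leb m]_z (G \o @tuple_cons R m) z by [].
rewrite -[in RHS](preimage_setT (@tuple_cons R m)).
by rewrite -ge0_integral_pushforward//; exact: measurable_tuple_cons.
Qed.

(** Coordinate 0 is covered by the recursive definition of the measure. For a later one, the first
    coordinate is frozen, the induction hypothesis is used on the tail, and the first coordinate is
    merged back. *)
Lemma tonelli_profile n (i : 'I_n) (G : n.-tuple R -> \bar R) :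
  measurable_fun setT G -> (forall s, 0 <= G s) ->
  \int[leb n]_s G s = \int[leb n.-1]_t \int[mu]_x G (profile i x t).
Proof.
elim: n i G => [[]//|n IH] i G mG G0.
case: (unliftP ord0 i) => [j ->|->]; last first.
  rewrite (integral_lebesgue_tuple_cons mG G0).2 /=.
  apply: eq_integral => t _; apply: eq_integral => x _; congr G.
  apply: eq_from_tnth => k.
  case: (unliftP ord0 k) => [l ->|->].
    by rewrite tnth_profile_lift tnthS.
  by rewrite tnth_profile.
rewrite (integral_lebesgue_tuple_cons mG G0).1; clear i.
case: n IH j G mG G0 => [|n] IH j G mG G0; first by case: j.
(* Inserting [x] at [j] and then prepending [y] equals prepending [y] and then inserting [x] one
   place later. *)
have tcp (y x : R) (t : n.-tuple R) :
    tuple_cons (y, profile j x t) = profile (lift ord0 j) x (tuple_cons (y, t)).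
  apply: eq_from_tnth => k.
  case: (unliftP (lift ord0 j) k) => [l ->|->]; last first.
    by rewrite tnth_profile tnthS tnth_profile.
  rewrite tnth_profile_lift.
  case: (unliftP ord0 l) => [l' ->|->].
    rewrite tnthS (_ : lift (lift ord0 j) (lift ord0 l') = lift ord0 (lift j l')).
      by rewrite tnthS tnth_profile_lift.
    by apply: val_inj; rewrite /= /bump /= !add1n ltnS addnS.
  by rewrite (_ : lift _ _ = ord0)//; apply: val_inj.
transitivity (\int[mu]_y \int[leb n]_t \int[mu]_x G (profile (lift ord0 j) x (tuple_cons (y, t)))).
  apply: eq_integral => y _; rewrite (IH j).
  - by apply: eq_integral => t _; apply: eq_integral => x _; rewrite tcp.
  - apply: (measurableT_comp mG).
    apply: (measurableT_comp (@measurable_tuple_cons R n.+1) (pair1_measurable y)).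
  - by [].
rewrite (integral_lebesgue_tuple_cons _ _).1//=.
- exact: (@measurable_integral_profile n.+2 (lift ord0 j) G mG G0).
- by move=> s; exact: integral_ge0.
Qed.

End tonelli_profile.

(** * Information rents *)

Section cube_integrals.
Context (R : realType) (a b : R).
Local Notation mu := (@lebesgue_measure R).
Local Notation leb := (lebesgue_tuple R).
Local Notation cube n := (@cube R a b n).

Lemma measurable_profilel d (T : measurableType d) n (i : 'I_n)
    (G : n.-tuple R -> T) (t : n.-1.-tuple R) :
  cube n.-1 t -> measurable_fun (cube n) G ->
  measurable_fun `[a, b] (fun x => G (profile i x t)).
Proof.
move=> ct mG.
apply: (@measurable_comp _ _ _ _ _ _ (cube n) G `[a, b]%classic (fun x => profile i x t)) => //.
- exact: measurable_cube.
- by move=> _ [x xab <-]; apply/cube_profile.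
- apply: measurable_funTS.
  exact: (measurableT_comp (measurable_profile i) (pair2_measurable t)).
Qed.

Lemma tonelli_cube n (i : 'I_n) (G : n.-tuple R -> \bar R) :
  measurable_fun (cube n) G -> (forall s, cube n s -> (0 <= G s)%E) ->
  (\int[leb n]_(s in cube n) G s =
   \int[leb n.-1]_(t in cube n.-1) \int[mu]_(x in `[a, b]) G (profile i x t))%E.
Proof.
move=> mG G0; rewrite integral_mkcond (@tonelli_profile _ _ i); first last.
- by move=> s; apply: erestrict_ge0.
- by apply/(measurable_restrictT _ _).1 => //; exact: measurable_cube.
rewrite [RHS]integral_mkcond; apply: eq_integral => t _.
rewrite patchE; case: ifPn => ct; last first.
  apply: integral0_eq => x _; rewrite patchE memNset//.
  by move/cube_profile => [_ tc]; rewrite (mem_set tc) in ct.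
rewrite [RHS]integral_mkcond; apply: eq_integral => x _; rewrite !patchE.
have -> // : (profile i x t \in cube n) = (x \in `[a, b]%classic).
apply/idP/idP; rewrite !inE/=.
  by move/cube_profile => [].
by move=> xab; apply/cube_profile; split => //; exact: set_mem.
Qed.

Lemma measurable_coordinate d (T : measurableType d) m (j : 'I_m) (g : R -> T) :
  measurable_fun `[a, b] g -> measurable_fun (cube m) (fun s => g (tnth s j)).
Proof.
move=> mg.
apply: (@measurable_comp _ _ _ _ _ _ `[a, b]%classic g (cube m) (fun s => tnth s j)) => //.
- by move=> _ [s cs <-]; exact: cs.
- by apply: measurable_funTS; exact: measurable_tnth.
Qed.

Lemma measurable_joint m (f : R -> R) :
  measurable_fun `[a, b] f -> measurable_fun (cube m) (@joint R m f).
Proof. by move=> mf; apply: measurable_prod => j _; exact: measurable_coordinate. Qed.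

Lemma joint_ge0 m (f : R -> R) (s : m.-tuple R) :
  (forall x, x \in `[a, b] -> 0 < f x) -> cube m s -> 0 <= joint f s.
Proof. by move=> f0 cs; apply: prodr_ge0 => j _; apply/ltW/f0/cs. Qed.

Section rent.
Context (n : nat) (i : 'I_n) (k : n.-tuple R -> R).
Hypotheses (k_meas : measurable_fun (cube n) k)
  (k_ge0 : forall s, cube n s -> 0 <= k s).

(* Information rent of agent i when k is the allocation times the marginal valuation. *)
Definition rent (s : n.-tuple R) : R :=
  \int[mu]_(y in `[a, tnth s i]) k (profile i y (others i s)).

(** The variable upper limit becomes the condition [y <= tnth s i] in the integrand. The rent is
    then a section integral of one nonnegative, jointly measurable function. *)
Lemma measurable_rent : measurable_fun (cube n) rent.
Proof.
have mcube := @measurable_cube R a b n.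
pose G (sy : n.-tuple R * R) : \bar R :=
  if sy.2 <= tnth sy.1 i then ((EFin \o k) \_ (cube n)) (profile i sy.2 (others i sy.1)) else 0%E.
have mG : measurable_fun setT G.
  apply: measurable_fun_ifT => //.
  - apply: measurable_fun_ler => //.
    exact: (measurableT_comp (measurable_tnth i) measurable_fst).
  - apply: measurableT_comp.
      by apply/(measurable_restrictT _ _).1 => //; exact/measurable_EFinP.
    apply: (measurableT_comp (measurable_profile i)
      (measurable_fun_pair measurable_snd
        (measurableT_comp (measurable_others i) measurable_fst))).
have G0 sy : (0 <= G sy)%E.
  rewrite /G; case: ifP => // _; apply: erestrict_ge0 => s cs.
  by rewrite lee_fin k_ge0.
have := @measurable_fun_fubini_tonelli_F _ _ _ _ R mu G mG G0.
move=> /(@measurable_funTS _ _ _ _ (cube n)) => mF.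
apply: (@eq_measurable_fun _ _ _ _ _ (fine \o fubini_F mu G)); last first.
  by apply: measurableT_comp => //; exact: fine_measurable.
move=> s; rewrite inE => cs; rewrite /rent /Rintegral /= /fubini_F.
congr fine; rewrite [RHS]integral_mkcond; apply: eq_integral => y _.
have [sab cos] := cube_others i cs.
rewrite /G /= !patchE mem_setE in_itv/=.
have [ys|] := leP y (tnth s i); last by rewrite andbF.
rewrite andbT.
have -> // : (profile i y (others i s) \in cube n) = (a <= y).
apply/idP/idP; rewrite inE.
  by move/cube_profile => [+ _]; rewrite in_itv/= => /andP[].
move=> ay; apply/cube_profile; split => //.
by move: sab; rewrite !in_itv/= => /andP[_ sb]; rewrite ay (le_trans ys).
Qed.

Lemma rent_ge0 s : cube n s -> 0 <= rent s.
Proof.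
move=> cs; apply: Rintegral_ge0 => y /=; rewrite in_itv/= => /andP[ay ys].
have [sab cos] := cube_others i cs.
apply: k_ge0; apply/cube_profile; split => //.
by move: sab; rewrite !in_itv/= => /andP[_ sb]; rewrite ay (le_trans ys).
Qed.

End rent.
End cube_integrals.

(** * The signal distribution and its survival function *)

Section density.
Context (R : realType) (a b : R) (f : R -> R).
Local Notation mu := (@lebesgue_measure R).
Hypothesis fd : is_density a b f.

Let mf : measurable_fun `[a, b] f. Proof. by case: fd. Qed.
Let f_gt0 x : x \in `[a, b] -> 0 < f x. Proof. by case: fd => _ + _; apply. Qed.
Let f_int : (\int[mu]_(x in `[a, b]) (f x)%:E = 1)%E. Proof. by case: fd. Qed.
Let fE_ge0 x : x \in `[a, b] -> (0 <= (f x)%:E)%E.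
Proof. by move=> xab; rewrite lee_fin ltW// f_gt0. Qed.

Lemma density_lt : a < b.
Proof.
rewrite ltNge; apply/negP => ba.
have : (\int[mu]_(x in `[a, b]) (f x)%:E = 0)%E.
  apply: (integral_Sset1 a) => x /=; rewrite in_itv/= => ?.
  by lra.
by rewrite f_int => /eqP; rewrite onee_eq0.
Qed.

Lemma survival_integral y : y \in `[a, b] ->
  (\int[mu]_(x in `[y, b]) (f x)%:E = (1 - cdf_of a f y)%:E)%E.
Proof.
rewrite in_itv/= => /andP[ay yb].
have := @ge0_integral_itvcc_split _ (EFin \o f) a y b ay yb.
move=> /(_ ltac:(exact/measurable_EFinP) fE_ge0) /=; rewrite f_int.
rewrite /cdf_of /Rintegral.
have i1 : (0 <= \int[mu]_(x in `[a, y]) (f x)%:E)%E.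
  by apply: integral_ge0 => x /=; rewrite in_itv/= => ?; apply: fE_ge0; rewrite in_itv/=; lra.
have i2 : (0 <= \int[mu]_(x in `[y, b]) (f x)%:E)%E.
  by apply: integral_ge0 => x /=; rewrite in_itv/= => ?; apply: fE_ge0; rewrite in_itv/=; lra.
(* Two nonnegative parts with sum 1 are finite, so the [fine] hidden in [cdf_of] loses nothing. *)
move: i1 i2; case: (\int[mu]_(x in `[a, y]) _)%E => [r| |] //;
  case: (\int[mu]_(x in `[y, b]) _)%E => [r'| |] //= _ _.
by rewrite -EFinD => -[->]; congr EFin; lra.
Qed.

Lemma survival_ge0 y : y \in `[a, b] -> 0 <= 1 - cdf_of a f y.
Proof.
move=> yab; rewrite -lee_fin -survival_integral//.
move: yab; rewrite in_itv/= => yab.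
by apply: integral_ge0 => x /=; rewrite in_itv/= => ?; apply: fE_ge0; rewrite in_itv/=; lra.
Qed.

(** With the density extended by 0, the tail integral is a nonincreasing function on the whole
    line. *)
Lemma measurable_survival : measurable_fun `[a, b] (fun y => 1 - cdf_of a f y).
Proof.
pose phi : R -> \bar R := (EFin \o f) \_ `[a, b].
have mphi : measurable_fun setT phi.
  by apply/(measurable_restrictT _ _).1 => //; exact/measurable_EFinP.
have phi0 x : (0 <= phi x)%E by apply: erestrict_ge0 => y; exact: fE_ge0.
pose S y : \bar R := (\int[mu]_(x in `[y, b]) phi x)%E.
have S0 y : (0 <= S y)%E by apply: integral_ge0.
have S1 y : (S y <= 1)%E.
  rewrite -f_int integral_mkcond; apply: ge0_subset_integral => //.
have Sf y : S y \is a fin_num.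
  by rewrite ge0_fin_numE// (le_lt_trans (S1 y))// ltry.
apply: (@eq_measurable_fun _ _ _ _ _ (fine \o S)).
  move=> y; rewrite inE => yab; rewrite -[RHS]/(fine (1 - cdf_of a f y)%:E) /=.
  rewrite -[RHS]/(fine (1 - cdf_of a f y)%:E) -survival_integral//; congr fine.
  apply: eq_integral => x; rewrite inE/= => xyb; rewrite /phi patchE mem_set//=.
  by move: yab xyb; rewrite /= !in_itv/= => ? ?; lra.
apply: nonincreasing_measurable => // x y xy.
apply: fine_le => //; apply: ge0_subset_integral => //.
  exact: measurable_funTS.
by apply: subset_itv; rewrite bnd_simp.
Qed.

(* Exchanging the order of integration over a <= y <= x <= b. *)
Lemma integral_density_rent (k : R -> R) :
  measurable_fun `[a, b] k -> (forall y, y \in `[a, b] -> 0 <= k y) ->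
  (\int[mu]_(x in `[a, b]) ((f x)%:E * \int[mu]_(y in `[a, x]) (k y)%:E) =
   \int[mu]_(y in `[a, b]) ((1 - cdf_of a f y) * k y)%:E)%E.
Proof.
move=> mk k0.
pose phi := f \_ `[a, b]; pose kappa := k \_ `[a, b].
have mphi : measurable_fun setT phi by apply/(measurable_restrictT _ _).1.
have mkappa : measurable_fun setT kappa by apply/(measurable_restrictT _ _).1.
have phi0 x : 0 <= phi x.
  by rewrite /phi patchE; case: ifPn => //; rewrite inE => xab; rewrite ltW// f_gt0.
have kappa0 x : 0 <= kappa x.
  by rewrite /kappa patchE; case: ifPn => //; rewrite inE => xab; rewrite k0.
pose G (xy : R * R) : \bar R := if xy.2 <= xy.1 then (phi xy.1 * kappa xy.2)%:E else 0%E.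
have mG : measurable_fun setT G.
  apply: measurable_fun_ifT => //; first exact: measurable_fun_ler.
  by apply/measurable_EFinP; apply: measurable_funM; exact: measurableT_comp.
have G0 xy : (0 <= G xy)%E.
  by rewrite /G; case: ifP => // _; rewrite lee_fin mulr_ge0.
transitivity (\int[mu]_x \int[mu]_y G (x, y))%E.
  rewrite integral_mkcond; apply: eq_integral => x _; rewrite patchE.
  case: ifPn; last first.
    move=> xab; apply/esym/integral0_eq => y _; rewrite /G /phi patchE/= (negbTE xab).
    by rewrite mul0r; case: ifP.
  rewrite inE => /= xab; have := xab; rewrite in_itv/= => /andP[ax xb].
  rewrite -ge0_integralZl_EFin//; last 3 first.
  - by move=> y /=; rewrite in_itv/= lee_fin => ?; apply: k0; rewrite in_itv/=; lra.
  - apply/measurable_EFinP; apply: measurable_funS mk => //.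
    by apply: subset_itv; rewrite bnd_simp.
  - by rewrite ltW// f_gt0.
  rewrite integral_mkcond; apply: eq_integral => y _.
  rewrite /G /phi /kappa !patchE /= !mem_setE xab !in_itv/=.
  have [yx|] := leP y x; last by rewrite andbF.
  rewrite (le_trans yx xb) !andbT; case: ifP => // _.
  by rewrite mulr0.
rewrite (@fubini_tonelli _ _ _ _ _ mu mu G)//.
rewrite [RHS]integral_mkcond; apply: eq_integral => y _; rewrite patchE.
case: ifPn; last first.
  move=> yab; apply: integral0_eq => x _; rewrite /G /kappa patchE/= (negbTE yab).
  by rewrite mulr0; case: ifP.
rewrite inE => /= yab; have := yab; rewrite in_itv/= => /andP[ay yb].
rewrite mulrC EFinM -survival_integral// -ge0_integralZl_EFin//; last 3 first.
- by move=> x /=; rewrite in_itv/= => ?; apply: fE_ge0; rewrite in_itv/=; lra.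
- apply/measurable_EFinP; apply: measurable_funS mf => //.
  by apply: subset_itv; rewrite bnd_simp.
- exact: k0.
rewrite [RHS]integral_mkcond; apply: eq_integral => x _.
rewrite /G /phi /kappa !patchE /= !mem_setE yab !in_itv/=.
have [yx|] := leP y x => //=.
rewrite (le_trans ay yx) /=; case: ifP => // _; first by rewrite mulrC EFinM.
by rewrite mul0r.
Qed.

End density.

(** * Virtual surplus *)

Section integral_comparison.
Local Open Scope ereal_scope.
Context d (T : measurableType d) (R : realType) (mu : {measure set T -> \bar R}).
Implicit Types (D : set T) (f g : T -> \bar R).

(** The integral of a nonnegative function is a supremum over the simple functions below it, hence
    monotone for arbitrary functions. Positive and negative parts are compared separately, in
    opposite directions. *)
Lemma le_integral_pointwise D f g : (forall x, D x -> f x <= g x) ->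
  \int[mu]_(x in D) f x <= \int[mu]_(x in D) g x.
Proof.
move=> fg; rewrite integralE [leRHS]integralE.
have mono (f' g' : T -> \bar R) : (forall x, 0 <= f' x) -> (forall x, D x -> f' x <= g' x) ->
    \int[mu]_(x in D) f' x <= \int[mu]_(x in D) g' x.
  move=> f0 fg'; rewrite !ge0_integralE => [|x Dx|//]; last first.
    exact: le_trans (f0 x) (fg' x Dx).
  apply: ereal_sup_le => _ [h /= hf <-]; exists h => // x.
  apply: (le_trans (hf x)); rewrite !patchE; case: ifPn => //.
  by rewrite inE => Dx; exact: fg'.
apply: leeB; apply: mono => // x Dx; rewrite ?funeposE ?funenegE.
- by rewrite ge_max le_max (fg x Dx)/= le_max lexx orbT.
- by rewrite ge_max !le_max leeN2 (fg x Dx)/= lexx orbT.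
Qed.

(* Only one of the two functions is measurable: it is replaced on the null set
   by +oo, resp. -oo, and the comparison becomes pointwise. *)
Lemma ae_le_integral_measurabler D f g : measurable D -> measurable_fun D g ->
  {ae mu, forall x, D x -> f x <= g x} ->
  \int[mu]_(x in D) f x <= \int[mu]_(x in D) g x.
Proof.
move=> mD mg [N [mN N0 fgN]].
pose g' x := if x \in N then +oo else g x.
rewrite [leRHS](ae_eq_integral g')//.
- apply: le_integral_pointwise => x Dx; rewrite /g'; case: ifPn => [_|xN].
    exact: leey.
  by move: xN; apply: contraNT => fgx; rewrite inE; apply: fgN => /(_ Dx); exact/negP.
- apply: measurable_fun_if => //.
  + by apply: measurable_funTS; apply: (measurable_fun_bool true); rewrite setTI preimage_mem_true.
  + by apply: measurable_funS mg.
- exists N; split => // x /= H; apply: contrapT => xN; apply: H => _.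
  by rewrite /g' memNset.
Qed.

Lemma ae_le_integral_measurablel D f g : measurable D -> measurable_fun D f ->
  {ae mu, forall x, D x -> f x <= g x} ->
  \int[mu]_(x in D) f x <= \int[mu]_(x in D) g x.
Proof.
move=> mD mf [N [mN N0 fgN]].
pose f' x := if x \in N then -oo else f x.
rewrite (ae_eq_integral f')//.
- apply: le_integral_pointwise => x Dx; rewrite /f'; case: ifPn => [_|xN].
    exact: leNye.
  by move: xN; apply: contraNT => fgx; rewrite inE; apply: fgN => /(_ Dx); exact/negP.
- apply: measurable_fun_if => //.
  + by apply: measurable_funTS; apply: (measurable_fun_bool true); rewrite setTI preimage_mem_true.
  + by apply: measurable_funS mf.
- exists N; split => // x /= H; apply: contrapT => xN; apply: H => _.
  by rewrite /f' memNset.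
Qed.

End integral_comparison.

(** The real power with exponent -1 agrees with the inverse on nonnegative reals, so it is applied
    to the square; at 0 both sides vanish. *)
Lemma measurable_fun_invr d (T : measurableType d) (R : realType) (D : set T) (f : T -> R) :
  measurable_fun D f -> measurable_fun D (fun x => (f x)^-1).
Proof.
move=> mf.
rewrite (_ : (fun x => _) = (fun x => f x * ((f x ^+ 2) `^ (-1)))).
  apply: measurable_funM => //.
  exact: (measurableT_comp (@measurable_powR R (-1)) (measurable_funX 2 mf)).
apply/funext => x; rewrite powR_inv1 ?sqr_ge0//.
have [->|fx0] := eqVneq (f x) 0; first by rewrite mul0r invr0.
by rewrite expr2 invfM mulrA divff// mul1r.
Qed.

(** * The boundary of the cube is negligible *)

Section boundary.
Context (R : realType).

Lemma negligible_coordinate n (i : 'I_n) (c : R) :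
  (lebesgue_tuple R n).-negligible [set s | tnth s i = c].
Proof.
have mE : measurable [set s : n.-tuple R | tnth s i = c].
  rewrite -[X in measurable X]setTI.
  exact: (measurable_tnth i measurableT (measurable_set1 c)).
apply/negligibleP => //.
have := @integral_indic _ _ R (lebesgue_tuple R n) setT measurableT _ mE.
rewrite setIT => H; apply: (etrans (esym H)); rewrite (@tonelli_profile _ _ i); last 2 first.
- by apply/measurable_EFinP; exact: measurable_indic.
- by move=> s; rewrite lee_fin.
apply: integral0_eq => t _.
have := @integral_indic _ _ R (@lebesgue_measure R) setT measurableT _ (measurable_set1 c).
rewrite setIT => H1; apply: etrans (etrans H1 (lebesgue_measure_set1 c)).
apply: eq_integral => x _; congr EFin; rewrite !indicE; congr (_ %:R); congr nat_of_bool.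
by apply/idP/idP; rewrite !inE/= tnth_profile.
Qed.

(** This discards the profiles with some signal at an end point, where subgradients are not
    controlled. *)
Lemma ae_interior n (a b : R) :
  {ae lebesgue_tuple R n, forall s, @cube R a b n s -> forall i, a < tnth s i < b}.
Proof.
(* Indexing by all naturals gives a countable union; [F k] is empty for [k >= n]. *)
pose F k := [set s : n.-tuple R | exists2 i : 'I_n, i = k :> nat &
  tnth s i = a \/ tnth s i = b].
apply: (@negligibleS _ _ _ _ (\bigcup_k F k)).
  move=> s /= H; apply: contrapT => nF; apply: H => cs i.
  have := cs i; rewrite in_itv/= => /andP[asi sib].
  rewrite !lt_neqAle asi sib !andbT; apply/andP; split; apply/eqP => E; apply: nF;
    exists i => //; exists i => //; [left|right] => //.
apply: negligible_bigcup => k.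
have [kn|nk] := ltnP k n; last first.
  rewrite (_ : F k = set0); first exact: negligible_set0.
  by apply/seteqP; split=> // s [i ik _]; move: nk; rewrite -ik leqNgt ltn_ord.
apply: (@negligibleS _ _ _ _ ([set s | tnth s (Ordinal kn) = a] `|`
                             [set s | tnth s (Ordinal kn) = b])).
  move=> s [i ik H]; rewrite (_ : Ordinal kn = i)//.
  by apply: val_inj; rewrite /= -ik.
by apply: negligibleU; exact: negligible_coordinate.
Qed.

End boundary.

(** * Virtual surplus as expected value net of information rents *)

Section surplus.
Context (R : realType) (a b : R) (f : R -> R) (n : nat).
Local Notation mu := (@lebesgue_measure R).
Local Notation leb := (lebesgue_tuple R).
Local Notation cube n := (@cube R a b n).
Implicit Types v q W : 'I_n -> n.-tuple R -> R.
Hypothesis fd : is_density a b f.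

Let f_gt0 x : x \in `[a, b] -> 0 < f x. Proof. by case: fd => _ + _; apply. Qed.

Let mjoint {m} : measurable_fun (cube m) (@joint R m f).
Proof. by apply: measurable_joint; case: fd. Qed.

Let mcube m : measurable (cube m). Proof. exact: measurable_cube. Qed.

#[local] Hint Resolve mjoint mcube : core.

Lemma measurable_fun_others (i : 'I_n) (B : n.-1.-tuple R -> R) :
  measurable_fun (cube n.-1) B -> measurable_fun (cube n) (fun s => B (others i s)).
Proof.
move=> mB; apply: (@measurable_comp _ _ _ _ _ _ (cube n.-1) B (cube n) (others i)) => //.
- exact: mcube.
- by move=> _ [s cs <-]; have [] := cube_others i cs.
- by apply: measurable_funTS; exact: measurable_others.
Qed.

(** A dominating function of the other signals suffices, because the density of the own signal
    integrates to 1. *)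
Lemma integrable_joint_le (i : 'I_n) (w : n.-tuple R -> R) (B : n.-1.-tuple R -> R) :
  measurable_fun (cube n) w -> measurable_fun (cube n.-1) B ->
  (forall s, cube n s -> `|w s| <= B (others i s)) ->
  (leb n.-1).-integrable (cube n.-1) (fun t => (B t * joint f t)%:E) ->
  (leb n).-integrable (cube n) (fun s => (w s * joint f s)%:E).
Proof.
move=> mw mB wB /integrableP[_ iB].
have mwj : measurable_fun (cube n) (fun s => (w s * joint f s)%:E).
  by apply/measurable_EFinP; exact: measurable_funM mw (@mjoint n).
apply/integrableP; split => //.
have j0 m (s : m.-tuple R) : cube m s -> 0 <= joint f s by exact: joint_ge0 f_gt0.
have mBs := measurable_fun_others i mB.
have mBj : measurable_fun (cube n) (fun s => (`|B (others i s)| * joint f s)%:E).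
  apply/measurable_EFinP.
  exact: (measurable_funM (measurableT_comp (@normr_measurable R setT) mBs) mjoint).
apply: (@le_lt_trans _ _ (\int[leb n]_(s in cube n) (`|B (others i s)| * joint f s)%:E)%E).
  apply: le_integral_pointwise => s cs.
  rewrite /= lee_fin normrM (ger0_norm (j0 _ _ cs)).
  by rewrite ler_wpM2r ?j0// (le_trans (wB s cs))// ler_norm.
rewrite (@tonelli_cube _ _ _ _ i)//; last first.
  by move=> s cs; rewrite lee_fin mulr_ge0 ?j0.
rewrite [ltLHS](_ : _ = \int[leb n.-1]_(t in cube n.-1) `|(B t * joint f t)%:E|)%E//.
apply: eq_integral => t; rewrite inE => ct.
transitivity (\int[mu]_(x in `[a, b]) ((`|B t| * joint f t)%:E * (f x)%:E))%E.
  apply: eq_integral => x _; rewrite others_profile joint_profile -EFinM.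
  by congr EFin; ring.
rewrite ge0_integralZl_EFin//; last 3 first.
- by move=> x /= xab; rewrite lee_fin ltW// f_gt0.
- by apply/measurable_EFinP; case: fd.
- by rewrite mulr_ge0 ?j0.
case: fd => _ _ ->; rewrite mule1 /= normrM (ger0_norm (j0 _ _ ct)).
by [].
Qed.

(** The inverse hazard rate. *)
Let survival_ratio (x : R) := (1 - cdf_of a f x) / f x.

Let survival_ratio_ge0 x : x \in `[a, b] -> 0 <= survival_ratio x.
Proof. by move=> xab; rewrite divr_ge0 ?(survival_ge0 fd)// ltW// f_gt0. Qed.

Let measurable_survival_ratio i :
  measurable_fun (cube n) (fun s => survival_ratio (tnth s i)).
Proof.
apply: measurable_coordinate; apply: measurable_funM.
  exact: measurable_survival.
by apply: measurable_fun_invr; case: fd.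
Qed.

(** For fixed other signals this is [integral_density_rent]; the own density in [joint] cancels the
    denominator of the inverse hazard rate. Finiteness of the inner integrals makes the real-valued
    [rent] faithful. *)
Lemma integral_rent_joint (i : 'I_n) (k : n.-tuple R -> R) :
  measurable_fun (cube n) k -> (forall s, cube n s -> 0 <= k s) ->
  (forall t, cube n.-1 t -> forall x, x \in `[a, b] ->
    \int[mu]_(y in `[a, x]) (k (profile i y t))%:E < +oo)%E ->
  (\int[leb n]_(s in cube n) (rent a i k s * joint f s)%:E =
   \int[leb n]_(s in cube n) (survival_ratio (tnth s i) * k s * joint f s)%:E)%E.
Proof.
move=> mk k0 kfin.
have mr := measurable_rent i mk k0.
have j0 m (s : m.-tuple R) : cube m s -> 0 <= joint f s by exact: joint_ge0 f_gt0.
rewrite (@tonelli_cube _ _ _ _ i); last 2 first.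
- by apply/measurable_EFinP; exact: measurable_funM mr mjoint.
- by move=> s cs; rewrite lee_fin mulr_ge0 ?j0// (rent_ge0 i k0).
rewrite (@tonelli_cube _ _ _ _ i); last 2 first.
- apply/measurable_EFinP.
  exact: measurable_funM (measurable_funM (measurable_survival_ratio i) mk) mjoint.
- move=> s cs; rewrite lee_fin.
  exact: mulr_ge0 (mulr_ge0 (survival_ratio_ge0 (cs i)) (k0 s cs)) (j0 _ _ cs).
apply: eq_integral => t; rewrite inE => ct.
have mkt := measurable_profilel i ct mk.
have kt0 y : y \in `[a, b] -> 0 <= k (profile i y t).
  by move=> yab; apply: k0; apply/cube_profile.
have it0 x : x \in `[a, b] -> (0 <= \int[mu]_(y in `[a, x]) (k (profile i y t))%:E)%E.
  rewrite in_itv/= => xab; apply: integral_ge0 => y /=; rewrite in_itv/= lee_fin => ?.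
  by apply: kt0; rewrite in_itv/=; lra.
transitivity (\int[mu]_(x in `[a, b]) ((joint f t)%:E *
    ((f x)%:E * \int[mu]_(y in `[a, x]) (k (profile i y t))%:E)))%E.
  apply: eq_integral => x; rewrite inE/= => xab.
  rewrite joint_profile /rent /Rintegral tnth_profile others_profile.
  rewrite !EFinM fineK; last by rewrite ge0_fin_numE ?it0// kfin.
  by rewrite muleC -!muleA muleCA.
rewrite ge0_integralZl_EFin//; last 3 first.
- by move=> x /= xab; rewrite mule_ge0 ?it0// lee_fin ltW// f_gt0.
- apply: (@eq_measurable_fun _ _ _ _ _ (fun x => (f x * rent a i k (profile i x t))%:E)).
    move=> x; rewrite inE/= => xab.
    rewrite /rent /Rintegral tnth_profile others_profile EFinM fineK//.
    by rewrite ge0_fin_numE ?it0// kfin.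
  apply/measurable_EFinP; apply: measurable_funM; first by case: fd.
  exact: measurable_profilel.
- exact: j0.
rewrite (integral_density_rent fd)//.
rewrite -ge0_integralZl_EFin//; last 3 first.
- by move=> x /= xab; rewrite lee_fin mulr_ge0 ?kt0// (survival_ge0 fd).
- by apply/measurable_EFinP; apply: measurable_funM => //; exact: measurable_survival.
- exact: j0.
apply: eq_integral => x; rewrite inE/= => xab.
rewrite tnth_profile joint_profile -EFinM; congr EFin; rewrite /survival_ratio.
by have := f_gt0 xab => fx0; field; rewrite gt_eqF.
Qed.

Context (v : 'I_n -> n.-tuple R -> R).
Hypotheses (hv : valuation a b v) (hr : regular a b f v).

(* A jointly measurable version of the partial derivatives of the valuations. *)
Definition marginal_valuation W :=
  [/\ forall i, measurable_fun (cube n) (W i),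
      forall i s, cube n s -> 0 <= W i s
    & forall i (t : n.-1.-tuple R), cube n.-1 t -> forall x, a < x < b ->
        is_subgradient a b (fun y => v i (profile i y t)) x (W i (profile i x t))].

Let ab : a < b := density_lt fd.
Let aab : a \in `[a, b]. Proof. by rewrite in_itv/= lexx ltW. Qed.
Let bab : b \in `[a, b]. Proof. by rewrite in_itv/= lexx ltW. Qed.

(** By monotonicity in the own signal, values lie between those at the two end points, whose
    integrability is part of [regular]. *)
Let v_bound (i : 'I_n) (t : n.-1.-tuple R) : R :=
  `|v i (profile i a t)| + `|v i (profile i b t)|.

Let measurable_profiler (i : 'I_n) x : x \in `[a, b] ->
  measurable_fun (cube n.-1) (fun t => v i (profile i x t)).
Proof.
move=> xab; have [mv _ _] := hr i.
apply: (@measurable_comp _ _ _ _ _ _ (cube n) (v i) (cube n.-1) (fun t => profile i x t)) => //.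
- exact: mcube.
- by move=> _ [t ct <-]; apply/cube_profile.
- by apply: measurable_funTS; exact: (measurableT_comp (measurable_profile i) (pair1_measurable x)).
Qed.

Let measurable_v_bound i : measurable_fun (cube n.-1) (v_bound i).
Proof.
apply: measurable_funD.
- exact: (measurableT_comp (@normr_measurable R setT) (measurable_profiler i aab)).
- exact: (measurableT_comp (@normr_measurable R setT) (measurable_profiler i bab)).
Qed.

Let integrable_v_bound i :
  (leb n.-1).-integrable (cube n.-1) (fun t => (v_bound i t * joint f t)%:E).
Proof.
have [_ ia ib] := hr i.
have H := integrableD (@mcube n.-1) (integrable_abse ia) (integrable_abse ib).
apply: (@eq_integrable _ _ _ _ _ (@mcube n.-1) _ _ _ H) => t; rewrite inE => ct /=.
have j0 : 0 <= joint f t by exact: joint_ge0 f_gt0 ct.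
by rewrite !normrM (ger0_norm j0) -EFinD mulrDl.
Qed.

Let v_le i t x y : cube n.-1 t -> x \in `[a, b] -> y \in `[a, b] -> x <= y ->
  v i (profile i x t) <= v i (profile i y t).
Proof. by move=> ct xab yab; have [_ _] := hv i ct; apply. Qed.

(** Since [q <= 1], the envelope formula bounds the integral; in particular every rent is finite. *)
Lemma rent_integral_le W q i t x : marginal_valuation W -> allocation_rule a b q ->
  cube n.-1 t -> x \in `[a, b] ->
  (\int[mu]_(y in `[a, x]) (q i (profile i y t) * W i (profile i y t))%:E <=
   (v i (profile i x t) - v i (profile i a t))%:E)%E.
Proof.
move=> [mW W0 sW] [mq q01 _] ct xab; have := xab; rewrite in_itv/= => /andP[ax xb].
have [_ vc vm] := hv i ct.
have mWt := measurable_profilel i ct (mW i).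
have Wt0 y : y \in `[a, b] -> 0 <= W i (profile i y t).
  by move=> yab; apply: W0; apply/cube_profile.
have sub : `[a, x]%classic `<=` `[a, b].
  by apply: subset_itv; rewrite bnd_simp.
rewrite -(integral_subgradient vc vm mWt Wt0 (sW i t ct) (lexx a) ax xb).
apply: le_integral_pointwise => y /sub yab; rewrite lee_fin.
rewrite ler_piMl ?Wt0//.
by have /andP[] : 0 <= q i (profile i y t) <= 1 by apply: q01; apply/cube_profile.
Qed.

Let measurable_product W q i : marginal_valuation W -> allocation_rule a b q ->
  measurable_fun (cube n) (q i \* W i)%R.
Proof. by move=> [mW _ _] [mq _ _]; exact: measurable_funM (mq i) (mW i). Qed.

Let product_ge0 W q i s : marginal_valuation W -> allocation_rule a b q ->
  cube n s -> 0 <= (q i \* W i) s.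
Proof.
move=> [_ W0 _] [_ q01 _] cs; rewrite mulr_ge0 ?W0//.
by have /andP[] := q01 i s cs.
Qed.

Lemma rent_le W q i s : marginal_valuation W -> allocation_rule a b q -> cube n s ->
  rent a i (q i \* W i) s <= v i s - v i (profile i a (others i s)).
Proof.
move=> hW hq cs; have [sab ct] := cube_others i cs.
have H := rent_integral_le i hW hq ct sab.
rewrite -lee_fin /rent /Rintegral fineK; first by rewrite profile_others in H.
rewrite ge0_fin_numE ?(le_lt_trans H) ?ltry//.
apply: integral_ge0 => y /=; rewrite in_itv/= => ?; rewrite lee_fin.
apply: (product_ge0 i hW hq); apply/cube_profile; split => //.
by move: sab; rewrite !in_itv/=; lra.
Qed.

Let integrable_value q i : allocation_rule a b q ->
  (leb n).-integrable (cube n) (fun s => (v i s * q i s * joint f s)%:E).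
Proof.
move=> [mq q01 _]; have [mv _ _] := hr i.
apply: (@integrable_joint_le i (fun s => v i s * q i s) (v_bound i)) => //.
  exact: measurable_funM mv (mq i).
move=> s cs; have [sab ct] := cube_others i cs.
have /andP[q0 q1] := q01 i s cs.
rewrite normrM (ger0_norm q0) (le_trans (ler_piMr _ q1))// /v_bound.
have := sab; rewrite in_itv/= => /andP[asi sib].
have ya := v_le i ct aab sab asi; have yb := v_le i ct sab bab sib.
rewrite profile_others in ya yb.
have := ler_norm (v i (profile i b (others i s))).
have := ler_norm (- v i (profile i a (others i s))); rewrite normrN.
have := normr_ge0 (v i (profile i a (others i s))).
have := normr_ge0 (v i (profile i b (others i s))).
by rewrite ler_norml => *; apply/andP; split; lra.
Qed.

Let integrable_rent W q i : marginal_valuation W -> allocation_rule a b q ->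
  (leb n).-integrable (cube n) (fun s => (rent a i (q i \* W i) s * joint f s)%:E).
Proof.
move=> hW hq.
have p0 s := @product_ge0 _ _ i s hW hq.
apply: (@integrable_joint_le i _ (v_bound i)) => //.
  by apply: measurable_rent => //; exact: measurable_product.
move=> s cs; have [sab ct] := cube_others i cs.
rewrite ger0_norm; last exact: (rent_ge0 i p0).
apply: (le_trans (rent_le i hW hq cs)); rewrite /v_bound.
have := sab; rewrite in_itv/= => /andP[asi sib].
have := v_le i ct sab bab sib; rewrite profile_others.
have := ler_norm (v i (profile i b (others i s))).
have := ler_norm (- v i (profile i a (others i s))); rewrite normrN.
lra.
Qed.

Let integral_survival W q i : marginal_valuation W -> allocation_rule a b q ->
  (\int[leb n]_(s in cube n) (rent a i (q i \* W i) s * joint f s)%:E =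
   \int[leb n]_(s in cube n) (survival_ratio (tnth s i) * (q i \* W i) s * joint f s)%:E)%E.
Proof.
move=> hW hq; apply: integral_rent_joint.
- exact: measurable_product.
- by move=> s; exact: product_ge0.
- by move=> t ct x xab; rewrite (le_lt_trans (rent_integral_le i hW hq ct xab))// ltry.
Qed.

(** The inverse hazard rate has no uniform bound in general. Integrability comes instead from the
    equality with the integral of the rent, the integrand being nonnegative. *)
Let integrable_survival W q i : marginal_valuation W -> allocation_rule a b q ->
  (leb n).-integrable (cube n)
    (fun s => (survival_ratio (tnth s i) * (q i \* W i) s * joint f s)%:E).
Proof.
move=> hW hq; apply/integrableP; split.
  apply/measurable_EFinP; apply: (measurable_funM _ mjoint).
  exact: (measurable_funM (measurable_survival_ratio i) (measurable_product i hW hq)).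
have j0 s : cube n s -> 0 <= joint f s by exact: joint_ge0 f_gt0.
under eq_integral => s.
  rewrite inE => cs; rewrite gee0_abs; last first.
    rewrite lee_fin.
    exact: mulr_ge0 (mulr_ge0 (survival_ratio_ge0 (cs i)) (product_ge0 i hW hq cs)) (j0 s cs).
  over.
rewrite -integral_survival//.
have /integrableP[_] := integrable_rent i hW hq; apply: le_lt_trans.
by apply: le_integral_pointwise => s cs; exact: lee_abs.
Qed.

(** All terms are integrable, so sums and differences leave the integral, and each hazard-rate term
    is exchanged for the corresponding rent. *)
Lemma virtual_surplus_rent W q : marginal_valuation W -> allocation_rule a b q ->
  virtual_surplus a b f v W q =
  revenue a b f (fun i s => v i s * q i s - rent a i (q i \* W i) s).
Proof.
move=> hW hq; rewrite /virtual_surplus /revenue.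
transitivity (\int[leb n]_(s in cube n) \sum_(i < n)
    ((v i s * q i s * joint f s)%:E -
     (survival_ratio (tnth s i) * (q i \* W i) s * joint f s)%:E))%E.
  apply: eq_integral => s _; under [RHS]eq_bigr do rewrite -EFinB.
  rewrite sumEFin mulr_suml; congr EFin; apply: eq_bigr => i _.
  by rewrite /virtual_value /survival_ratio /=; ring.
rewrite (integral_sum (@mcube n)); last first.
  move=> i; exact: (integrableB (@mcube n) (integrable_value i hq) (integrable_survival i hW hq)).
apply: eq_bigr => i _.
rewrite (@integralB _ _ _ _ _ (@mcube n) _ _ (integrable_value i hq) (integrable_survival i hW hq)).
rewrite -integral_survival//.
rewrite -(@integralB _ _ _ _ _ (@mcube n) _ _ (integrable_value i hq) (integrable_rent i hW hq)).
by apply: eq_integral => s _; rewrite -EFinB; congr EFin; rewrite mulrBl.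
Qed.

Lemma measurable_virtual_surplus W q : marginal_valuation W -> allocation_rule a b q ->
  measurable_fun (cube n)
    (fun s => (\sum_(i < n) virtual_value a f v W i s * q i s) * joint f s).
Proof.
move=> [mW _ _] [mq _ _]; apply: (measurable_funM _ mjoint).
apply: measurable_sum => i; apply: (measurable_funM _ (mq i)).
have [mv _ _] := hr i; apply: (measurable_funB mv).
exact: (measurable_funM (measurable_survival_ratio i) (mW i)).
Qed.

End surplus.

(** * Optimal mechanisms *)

Section optimal_mechanism.
Context (R : realType) (a b : R) (f : R -> R) (n : nat)
  (v : 'I_n -> n.-tuple R -> R).
Local Notation mu := (@lebesgue_measure R).
Local Notation cube n := (@cube R a b n).
Hypotheses (fd : is_density a b f) (hv : valuation a b v) (hr : regular a b f v).

Let ab : a < b := density_lt fd.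
Let aab : a \in `[a, b]. Proof. by rewrite in_itv/= lexx ltW. Qed.

(** A point [m] taking the mean of the values at [a] and [x] lies strictly before [x] and bounds the
    plateau, which keeps the inequality strict for the supremum. *)
Lemma ell_lt i t x : cube n.-1 t -> x \in `[a, b] ->
  v i (profile i a t) < v i (profile i x t) -> ell a b v i t < x.
Proof.
move=> ct xab hx; have [_ hc hm] := hv i ct.
have := xab; rewrite in_itv/= => /andP[ax xb].
pose h y := v i (profile i y t).
have [m mab hmE] : exists2 m, m \in `[a, x] & h m = (h a + h x) / 2.
  apply: IVT => //.
    by apply: continuous_subspaceW hc; apply: subset_itv; rewrite bnd_simp.
  by rewrite min_l ?max_r; rewrite /h; [apply/andP; split; lra|lra|lra].
move: mab; rewrite in_itv/= => /andP[am mx].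
have mltx : m < x.
  rewrite lt_neqAle mx andbT; apply/eqP => E; move: hmE; rewrite E /h; lra.
apply: (le_lt_trans _ mltx); apply: ge_sup; first by exists a.
move=> y [yab hya]; rewrite leNgt; apply/negP => my.
have : h m <= h y.
  apply: hm => //; last exact: ltW.
  by rewrite in_itv/=; lra.
by rewrite /h in hmE *; lra.
Qed.

Lemma ell_gt i t x : cube n.-1 t -> x \in `[a, b] ->
  ell a b v i t < x -> v i (profile i a t) < v i (profile i x t).
Proof.
move=> ct xab ltx; have [_ _ hm] := hv i ct.
have := xab; rewrite in_itv/= => /andP[ax xb].
rewrite lt_neqAle (hm _ _ aab xab ax) andbT; apply/eqP => E.
move: ltx; rewrite ltNge => /negP; apply; apply: ub_le_sup => //.
by exists b => y [+ _]; rewrite in_itv/= => /andP[].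
Qed.

Lemma eventually_monotone_profile q i t x y : eventually_monotone a b v q ->
  cube n.-1 t -> a <= x -> x <= y -> y <= b ->
  v i (profile i a t) < v i (profile i y t) ->
  q i (profile i x t) <= q i (profile i y t).
Proof.
move=> em ct ax; rewrite le_eqVlt => /predU1P[->//|xy] yb hay.
have yab : y \in `[a, b] by rewrite in_itv/=; lra.
by apply: em => //; [rewrite in_itv/=; lra|exact: ell_lt].
Qed.

(** Adding the two EPIC inequalities shows that allocation and value increments have the same sign.
    The value increment is strictly positive: past the plateau, a convex function that has risen
    cannot become flat again. *)
Lemma EPIC_eventually_monotone q p : EPIC a b v q p -> eventually_monotone a b v q.
Proof.
move=> ic i t ct x x' xab x'ab xx' lx.
have [hc _ hm] := hv i ct.
have := xab; have := x'ab; rewrite !in_itv/= => /andP[ax' x'b] /andP[ax xb].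
have hax := ell_gt ct xab lx.
have lt_v : v i (profile i x' t) < v i (profile i x t).
  rewrite lt_neqAle (hm _ _ x'ab xab (ltW xx')) andbT; apply/eqP => /= E.
  have [ax'0|ax'0] := eqVneq a x'; first by move: hax; rewrite ax'0 E ltxx.
  have lax' : a < x' by rewrite lt_neqAle ax'0.
  have := convex_function_slopes hc (lexx a) lax' xx' xb.
  rewrite /= E; move: hax.
  by move: (v i _) (v i _) => r r' H; rewrite subrr mul0r; nra.
have := ic i t ct x x' xab x'ab; have := ic i t ct x' x x'ab xab.
move: lt_v; move: (v i _) (v i _) (q i _) (q i _) (net_payoff _ _ _ _ _) (net_payoff _ _ _ _ _).
by move=> *; nra.
Qed.

Let measurable_slope i c k : c \in `[a, b] ->
  measurable_fun (cube n)
    (fun s => slope (fun y => v i (profile i y (others i s))) c k (tnth s i)).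
Proof.
move=> cab; have [mv _ _] := hr i.
have mstep : measurable_fun setT (fun s : n.-tuple R => (c - tnth s i) / k.+1%:R).
  apply: measurable_funM => //; apply: measurable_funB => //; exact: measurable_tnth.
apply: measurable_funM; last first.
  by apply: measurable_fun_invr; exact: measurable_funTS.
apply: measurable_funB; last first.
  by apply: (eq_measurable_fun (v i)) => // s _; rewrite profile_others.
apply: (@measurable_comp _ _ _ _ _ _ (cube n) (v i) (cube n)
  (fun s => profile i (tnth s i + (c - tnth s i) / k.+1%:R) (others i s))) => //.
- exact: measurable_cube.
- move=> _ [s cs <-]; have [sab ct] := cube_others i cs; apply/cube_profile; split => //.
  have k0 : 0 < k.+1%:R^-1 :> R by rewrite invr_gt0.
  have k1 : k.+1%:R^-1 <= 1 :> R by rewrite invf_le1// ler1n.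
  move: sab cab; rewrite !in_itv/= => /andP[? ?] /andP[? ?].
  by move: (k.+1%:R^-1) k0 k1 => e e0 e1; apply/andP; split; nra.
- apply: measurable_funTS.
  have mpt : measurable_fun setT (fun s : n.-tuple R => tnth s i + (c - tnth s i) / k.+1%:R).
    by apply: measurable_funD => //; exact: measurable_tnth.
  exact: (measurableT_comp (measurable_profile i)
    (measurable_fun_pair mpt (measurable_others i))).
Qed.

Let interior i (s : n.-tuple R) := a < tnth s i < b.

Let measurable_interior i : measurable_fun (cube n) (interior i).
Proof.
apply: measurable_funTS; apply: measurable_and; apply: measurable_fun_ltr => //;
  exact: measurable_tnth.
Qed.

(** At [a] the left quotients are 0/0 and at [b] they can be unbounded. The value 0 keeps the
    function nonnegative, and the boundary is null. *)
Definition left_marginal i (s : n.-tuple R) : R :=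
  if interior i s
  then left_slope a (fun y => v i (profile i y (others i s))) (tnth s i) else 0.

Definition right_marginal i (s : n.-tuple R) : R :=
  if interior i s
  then right_slope b (fun y => v i (profile i y (others i s))) (tnth s i) else 0.

Let subgradient_ge0 i t x g : cube n.-1 t -> a < x < b ->
  is_subgradient a b (fun y => v i (profile i y t)) x g -> 0 <= g.
Proof.
move=> ct /andP[ax xb] /(_ a aab); have [_ _ hm] := hv i ct.
have xab : x \in `[a, b] by rewrite in_itv/=; lra.
have := hm _ _ aab xab (ltW ax).
by move: (v i _) (v i _) => r r' *; nra.
Qed.

Lemma left_marginal_valuation : marginal_valuation a b v left_marginal.
Proof.
split.
- move=> i; apply: measurable_fun_if => //; first exact: measurable_cube.
  (* As a countable supremum of measurable quotients, bounded at interior signals, the left slope is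
     measurable. *)
  have E s : left_slope a (fun y => v i (profile i y (others i s))) (tnth s i) =
      sups (fun k => slope (fun y => v i (profile i y (others i s))) a k (tnth s i)) 0.
    rewrite /left_slope /sups/=; congr sup; apply/seteqP.
    by split=> [_ [k _ <-]|_ [k _ <-]]; exists k.
  under eq_fun do rewrite E.
  apply: measurable_fun_sups => [s [cs]|k].
    rewrite /= => axb; have [sab ct] := cube_others i cs; have [hc _ _] := hv i ct.
    exact: (left_slope_ub hc axb).
  apply: measurable_funS (measurable_slope i k aab) => //; exact: measurable_cube.
- move=> i s cs; rewrite /left_marginal; case: ifPn => // axb.
  have [sab ct] := cube_others i cs; have [hc _ _] := hv i ct.
  exact: (subgradient_ge0 ct axb (left_slope_subgradient hc axb)).
- move=> i t ct x axb; have [hc _ _] := hv i ct.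
  rewrite /left_marginal /interior tnth_profile others_profile axb.
  exact: left_slope_subgradient.
Qed.

Lemma right_marginal_valuation : marginal_valuation a b v right_marginal.
Proof.
split.
- move=> i; apply: measurable_fun_if => //; first exact: measurable_cube.
  have E s : right_slope b (fun y => v i (profile i y (others i s))) (tnth s i) =
      infs (fun k => slope (fun y => v i (profile i y (others i s))) b k (tnth s i)) 0.
    rewrite /right_slope /infs/=; congr inf; apply/seteqP.
    by split=> [_ [k _ <-]|_ [k _ <-]]; exists k.
  under eq_fun do rewrite E.
  apply: measurable_fun_infs => [s [cs]|k].
    rewrite /= => axb; have [sab ct] := cube_others i cs; have [hc _ _] := hv i ct.
    exact: (right_slope_lb hc axb).
  have bab : b \in `[a, b] by rewrite in_itv/= lexx ltW.
  apply: measurable_funS (measurable_slope i k bab) => //; exact: measurable_cube.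
- move=> i s cs; rewrite /right_marginal; case: ifPn => // axb.
  have [sab ct] := cube_others i cs; have [hc _ _] := hv i ct.
  exact: (subgradient_ge0 ct axb (right_slope_subgradient hc axb)).
- move=> i t ct x axb; have [hc _ _] := hv i ct.
  rewrite /right_marginal /interior tnth_profile others_profile axb.
  exact: right_slope_subgradient.
Qed.

Lemma partial_derivative_bounds dv i s : is_partial_derivative a b v dv ->
  cube n s -> interior i s -> left_marginal i s <= dv i s <= right_marginal i s.
Proof.
move=> hdv cs axb; have [sab ct] := cube_others i cs; have [hc _ _] := hv i ct.
have hsub := derivative_selection_subgradient hc (hdv i _ ct) axb.
rewrite profile_others in hsub.
by rewrite /left_marginal /right_marginal axb (left_slope_le axb hsub) (right_slope_ge axb hsub).
Qed.

(** The order is reversed: the marginal valuation enters with a minus sign and a nonnegative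
    weight. *)
Lemma virtual_surplus_mono W W' q : allocation_rule a b q ->
  (forall i s, cube n s -> interior i s -> W' i s <= W i s) ->
  forall s, cube n s -> (forall i, interior i s) ->
  (\sum_(i < n) virtual_value a f v W i s * q i s) * joint f s <=
  (\sum_(i < n) virtual_value a f v W' i s * q i s) * joint f s.
Proof.
move=> [_ q01 _] WW s cs int.
have f0 x : x \in `[a, b] -> 0 < f x by case: fd => _ + _; apply.
rewrite ler_wpM2r ?(joint_ge0 f0)//; apply: ler_sum => i _.
have /andP[q0 _] := q01 i s cs.
rewrite ler_wpM2r// /virtual_value lerB// ler_wpM2l ?WW//.
by rewrite divr_ge0 ?(survival_ge0 fd (cs i))// ltW// f0// cs.
Qed.

(** * The mechanism whose net payoffs are the information rents *)

Section rent_mechanism.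
Context (W : 'I_n -> n.-tuple R -> R) (q : 'I_n -> n.-tuple R -> R).
Hypotheses (hW : marginal_valuation a b v W) (hq : allocation_rule a b q)
  (em : eventually_monotone a b v q).

Let k i (s : n.-tuple R) := q i s * W i s.

Let k_meas i : measurable_fun (cube n) (k i).
Proof. by case: hW hq => [mW _ _] [mq _ _]; exact: measurable_funM (mq i) (mW i). Qed.

Let k_ge0 i s : cube n s -> 0 <= k i s.
Proof.
case: hW hq => [_ W0 _] [_ q01 _] cs; rewrite mulr_ge0 ?W0//.
by have /andP[] := q01 i s cs.
Qed.

Let qt01 i t : cube n.-1 t -> forall x, x \in `[a, b] -> 0 <= q i (profile i x t) <= 1.
Proof. by case: hq => _ q01 _ ct x xab; apply: q01; apply/cube_profile. Qed.

Let Wt_ge0 i t : cube n.-1 t -> forall x, x \in `[a, b] -> 0 <= W i (profile i x t).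
Proof. by case: hW => _ W0 _ ct x xab; apply: W0; apply/cube_profile. Qed.

Let rentE i t x : cube n.-1 t -> x \in `[a, b] ->
  (\int[mu]_(y in `[a, x]) (k i (profile i y t))%:E = (rent a i (k i) (profile i x t))%:E)%E.
Proof.
move=> ct xab; rewrite /rent /Rintegral tnth_profile others_profile fineK//.
have := xab; rewrite in_itv/= => /andP[ax xb].
rewrite ge0_fin_numE; first by rewrite (le_lt_trans (rent_integral_le hv i hW hq ct xab)) ?ltry.
apply: integral_ge0 => y /=; rewrite in_itv/= lee_fin => ?.
by apply: k_ge0; apply/cube_profile; split => //; rewrite in_itv/=; lra.
Qed.

(** The increment is the integral over [x, y], squeezed by [integral_allocation_ge] and
    [integral_allocation_le]. *)
Let rent_increment i t x y : cube n.-1 t -> x \in `[a, b] -> y \in `[a, b] -> x <= y ->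
  q i (profile i x t) * (v i (profile i y t) - v i (profile i x t)) <=
  rent a i (k i) (profile i y t) - rent a i (k i) (profile i x t) <=
  q i (profile i y t) * (v i (profile i y t) - v i (profile i x t)).
Proof.
move=> ct xab yab xy; have [_ vc vm] := hv i ct.
have [mW _ sW] := hW; have [mq _ _] := hq.
have := xab; have := yab; rewrite !in_itv/= => /andP[ay yb] /andP[ax xb].
have mono x' y' : a <= x' -> x' <= y' -> y' <= b ->
    v i (profile i a t) < v i (profile i y' t) ->
    q i (profile i x' t) <= q i (profile i y' t).
  by move=> *; exact: eventually_monotone_profile.
have lo := integral_allocation_ge vc vm (measurable_profilel i ct (mW i)) (Wt_ge0 i ct)
  (sW i t ct) (measurable_profilel i ct (mq i)) (qt01 i ct) mono ax xy yb.
have hi := integral_allocation_le vc vm (measurable_profilel i ct (mW i)) (Wt_ge0 i ct)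
  (sW i t ct) (measurable_profilel i ct (mq i)) (qt01 i ct) mono ax xy yb.
have k0 z : z \in `[a, y] -> (0 <= (k i (profile i z t))%:E)%E.
  rewrite in_itv/= lee_fin => ?; apply: k_ge0; apply/cube_profile.
  by split => //; rewrite in_itv/=; lra.
have mk : measurable_fun `[a, y] (fun z => (k i (profile i z t))%:E).
  apply/measurable_EFinP; apply: measurable_funS (measurable_profilel i ct (k_meas i)) => //.
  by apply: subset_itv; rewrite bnd_simp.
have := ge0_integral_itvcc_split ax xy mk k0.
rewrite !rentE// => E.
have {}E : (\int[mu]_(z in `[x, y]) (k i (profile i z t))%:E =
    (rent a i (k i) (profile i y t) - rent a i (k i) (profile i x t))%:E)%E.
  move: E; case: (\int[mu]_(z in `[x, y]) _)%E => [r| |]//.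
  by rewrite -EFinD => -[->]; congr EFin; lra.
by move: lo hi; rewrite E !lee_fin => -> ->.
Qed.

(** Net payoffs equal the rents, which are nonnegative. The upper half of [rent_increment] excludes
    overreporting, the lower half underreporting. *)
Lemma rent_mechanism_feasible :
  feasible a b v q (fun i s => v i s * q i s - rent a i (k i) s).
Proof.
have u i s : net_payoff v q (fun i s => v i s * q i s - rent a i (k i) s) i s = rent a i (k i) s.
  by rewrite /net_payoff; ring.
split => //.
- move=> i; have [mv _ _] := hr i; have [mq _ _] := hq.
  exact: measurable_funB (measurable_funM mv (mq i)) (measurable_rent i (k_meas i) (k_ge0 i)).
- move=> i t ct x x' xab x'ab; rewrite !u.
  have [xx'|/ltW x'x] := leP x x'.
    by have /andP[_] := rent_increment i ct xab x'ab xx'; lra.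
  by have /andP[+ _] := rent_increment i ct x'ab xab x'x; lra.
- by move=> i s cs; rewrite u; exact: (rent_ge0 i (k_ge0 i)).
Qed.

(** By [integral_allocation_le_payoff], the net payoff as a function of the own signal dominates the
    rent; the payment is value minus net payoff. *)
Lemma payment_le_rent p i s : EPIC a b v q p -> EPIR a b v q p -> cube n s ->
  p i s <= v i s * q i s - rent a i (k i) s.
Proof.
move=> ic ir cs; have [sab ct] := cube_others i cs.
have [_ vc vm] := hv i ct; have [mW _ sW] := hW; have [mq _ _] := hq.
have := sab; rewrite in_itv/= => /andP[asi sib].
have mono x' y' : a <= x' -> x' <= y' -> y' <= b ->
    v i (profile i a (others i s)) < v i (profile i y' (others i s)) ->
    q i (profile i x' (others i s)) <= q i (profile i y' (others i s)).
  by move=> *; exact: eventually_monotone_profile.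
have := @integral_allocation_le_payoff R a b _ _ vc vm
  (measurable_profilel i ct (mW i)) (Wt_ge0 i ct)
  (sW i _ ct) _ (measurable_profilel i ct (mq i)) (qt01 i ct) mono
  (fun x => net_payoff v q p i (profile i x (others i s))) (tnth s i).
rewrite (rentE i ct sab) lee_fin profile_others /net_payoff => H.
suff : rent a i (k i) s <= q i s * v i s - p i s by lra.
apply: H => // [y yab|y z yab zab].
- by have := ir i (profile i y (others i s)); apply; apply/cube_profile.
- exact: ic.
Qed.

End rent_mechanism.
End optimal_mechanism.

Theorem lemma1 (R : realType) (n : nat) (a b : R) (f : R -> R)
    (v dv q p : 'I_n -> n.-tuple R -> R) :
  is_density a b f ->
  valuation a b v ->
  regular a b f v ->
  is_partial_derivative a b v dv ->
  optimal a b f v q p ->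
  eventually_monotone a b v q /\
  (forall q', allocation_rule a b q' -> eventually_monotone a b v q' ->
     (virtual_surplus a b f v dv q' <= virtual_surplus a b f v dv q)%E).
Proof.
move=> fd hv hr hdv [[hq hp ic ir] opt].
have em := EPIC_eventually_monotone fd hv ic.
split=> // q' hq' em'.
have f0 x : x \in `[a, b] -> 0 < f x by case: fd => _ + _; apply.
have hL := left_marginal_valuation fd hv hr.
have hR := right_marginal_valuation fd hv hr.
pose L := left_marginal a b v; pose U := right_marginal a b v.
apply: (@le_trans _ _ (virtual_surplus a b f v L q')).
  apply: ae_le_integral_measurabler.
  - exact: measurable_cube.
  - by apply/measurable_EFinP; exact: measurable_virtual_surplus.
  (* At interior profiles [L] is at most [dv], and a smaller marginal valuation gives a larger
     surplus. *)
  - apply: filterS (ae_interior n a b) => s int cs; rewrite lee_fin.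
    apply: (virtual_surplus_mono v fd hq') => // [i s' cs' int'|]; last exact: int.
    by have /andP[] := partial_derivative_bounds hv hdv cs' int'.
rewrite (virtual_surplus_rent fd hv hr hL hq').
(* Optimality is tested against the rent mechanism of the competitor [q']. *)
apply: (le_trans (opt _ _ (rent_mechanism_feasible fd hv hr hL hq' em'))).
(* The optimal payments are pointwise at most those of the rent mechanism of [q] itself, here with
   rents computed from [U]. *)
apply: (@le_trans _ _ (virtual_surplus a b f v U q)).
  rewrite (virtual_surplus_rent fd hv hr hR hq).
  apply: lee_sum => i _; apply: le_integral_pointwise => s cs; rewrite lee_fin.
  rewrite ler_wpM2r ?(joint_ge0 f0 cs)//.
  exact: (payment_le_rent fd hv hR hq em).
apply: ae_le_integral_measurablel.
- exact: measurable_cube.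
- by apply/measurable_EFinP; exact: measurable_virtual_surplus.
- apply: filterS (ae_interior n a b) => s int cs; rewrite lee_fin.
  apply: (virtual_surplus_mono v fd hq) => // [i s' cs' int'|]; last exact: int.
  by have /andP[] := partial_derivative_bounds hv hdv cs' int'.
Qed.
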